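(* Let $X>0$, $c_0\in(0,1)$ and $\mu\in(0,\frac1{100})$. There exists a constant $\beta>0$ depending only on $\mu$, $c_0$ and $X$ such that the following holds. Let $T>0$, $D=(0,T]\times(0,X]\times(0,1)$, $\alpha_0\in(0,1)$, $C_1>0$, and set $$b=\frac{c_0}{4}e^{-\beta X}e^{-\frac83},\qquad K=e^X\max\{2,\,2C_1^{\frac1{\alpha_0}-1}\},$$ $$\delta=\min\Big\{\tfrac1{10}\min_{\alpha\in[\frac{\alpha_0}{2},\alpha_0]}\alpha(1-\alpha)b^2,\ \tfrac{1}{321e^{X}},\ \tfrac{\min\{1,C_1\}}{b\,2^{\alpha_0}}\Big\}.$$ Let $w$ be an Oleinik monotone solution of the Crocco problem in $D$ with data $w_0=w|_{\tau=0}$, $w_1=w|_{\xi=0}$ satisfying $$c_0(1-\eta)\le w_1\le c_0^{-1}(1-\eta)\sqrt{-\ln(\mu(1-\eta))},\qquad c_0(1-\eta)\le w_0\le c_0^{-1}(1-\eta)\sqrt{-\ln(\mu(1-\eta))},$$ and, both on $\{\xi=0\}$ and on $\{\tau=0\}$, $$-C_1(1-\eta)^{\alpha_0}\le\partial_\xi w+\partial_\tau w\le\frac{(\delta b)^{\frac1{\alpha_0}}}{K}(1-\eta),\qquad -C_1(1-\eta)^{\alpha_0}\le\partial_\tau w\le b\delta(1-\eta)^{\alpha_0}.$$ Then in $D$: $$b(1-\eta)\le w\le c_0^{-1}(1-\eta)\sqrt{-\ln(\mu(1-\eta))},\qquad -C_1(1-\eta)^{\alpha_0}\le\partial_\xi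 w+\partial_\tau w\le\frac{\delta}{2}w,$$ $$w\,\partial_\eta^2w\le2\delta,\qquad -C_1(1-\eta)^{\alpha_0}\le\partial_\tau w\le b\delta(1-\eta)^{\alpha_0}.$$
   Context: Crocco problem in $D=(0,T]\times(0,X]\times(0,1)$ (variables $(\tau,\xi,\eta)$): $-\partial_\tau w-\eta\,\partial_\xi w+w^2\partial_\eta^2w=0$ in $D$; boundary conditions $w\,\partial_\eta w|_{\eta=0}=0$, $w|_{\eta=1}=0$; data $w|_{\tau=0}=w_0(\xi,\eta)$, $w|_{\xi=0}=w_1(\tau,\eta)$. An Oleinik monotone solution is a (global in $\tau$) solution $w\in C^2([0,+\infty)\times[0,X]\times[0,1))\cap C^3((0,+\infty)\times(0,X]\times(0,1))$ of this problem such that $\lim_{\eta\to1}\partial_\xi w=\lim_{\eta\to1}\partial_\tau w=0$ and $\lim_{\eta\to1}w\,\partial_\eta^2w=l(\tau,\xi)$ for some continuous function $l$. Here $w,\partial_\xi w,\partial_\tau w$ are understood to extend continuously to $\eta=1$ with value $0$, and $w\partial_\eta^2w$ to extend continuously to $\eta=1$ with value $l$. Conditions ''on $\{\xi=0\}$'' and ''on $\{\tau=0\}$'' refer to the corresponding faces of $\overline D$. *)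

(* Defs.v *)
From Stdlib Require Export Reals.
From Coquelicot Require Export Coquelicot.
Open Scope R_scope.

(** Derivative of [f] at [x] along the subset [D] of the line: two-sided at
    interior points of [D], one-sided at its end points.  As with [Derive], the
    value is unspecified where the limit does not exist. *)
Definition is_derive_in (D : R -> Prop) (f : R -> R) (x l : R) : Prop :=
  D_in f (fun _ => l) D x.

Definition Derive_in (D : R -> Prop) (f : R -> R) (x : R) : R :=
  iota (is_derive_in D f x).

(** Points of space are triples [(t, x, e)], standing for (τ, ξ, η). *)
Definition point : Type := (R * R * R)%type.

Inductive axis : Set := Tau | Xi | Eta.

Definition coord (i : axis) (p : point) : R :=
  let '(t, x, e) := p in
  match i with Tau => t | Xi => x | Eta => e end.

Definition with_coord (i : axis) (p : point) (s : R) : point :=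
  let '(t, x, e) := p in
  match i with Tau => (s, x, e) | Xi => (t, s, e) | Eta => (t, x, s) end.

(** Partial derivatives relative to a set [S] (one-sided on faces in [S]). *)
Definition is_pd (i : axis) (S : point -> Prop) (f : point -> R)
    (p : point) (l : R) : Prop :=
  is_derive_in (fun s => S (with_coord i p s))
               (fun s => f (with_coord i p s)) (coord i p) l.

Definition pd (i : axis) (S : point -> Prop) (f : point -> R)
    (p : point) : R :=
  Derive_in (fun s => S (with_coord i p s))
            (fun s => f (with_coord i p s)) (coord i p).

(** [C^n] on [S], up to the part of the boundary contained in [S]. *)
Fixpoint C_on (n : nat) (S : point -> Prop) (f : point -> R) : Prop :=
  continuous_on S f /\
  match n with
  | O => True
  | Datatypes.S m =>
      forall i : axis,
        (forall p, S p -> exists l, is_pd i S f p l) /\ C_on m S (pd i S f)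
  end.

Definition crocco_domain (T X : R) (p : point) : Prop :=
  let '(t, x, e) := p in 0 < t <= T /\ 0 < x <= X /\ 0 < e < 1.

Definition crocco_domain_inf (X : R) (p : point) : Prop :=
  let '(t, x, e) := p in 0 < t /\ 0 < x <= X /\ 0 < e < 1.

Definition closed_crocco_domain_inf (X : R) (p : point) : Prop :=
  let '(t, x, e) := p in 0 <= t /\ 0 <= x <= X /\ 0 <= e < 1.

(** The faces {ξ = 0} and {τ = 0} of the closure of [crocco_domain T X], without the
    edge η = 1: there [w] and its tangential derivatives vanish and the bounds
    have to be read as 0 <= 0 (in Rocq, [Rpower 0 a = 1] and [ln 0 = 0]). *)
Definition face_xi0 (T : R) (p : point) : Prop :=
  let '(t, x, e) := p in 0 <= t <= T /\ x = 0 /\ 0 <= e < 1.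

Definition face_tau0 (X : R) (p : point) : Prop :=
  let '(t, x, e) := p in t = 0 /\ 0 <= x <= X /\ 0 <= e < 1.

Definition d_tau (X : R) (w : point -> R) : point -> R :=
  pd Tau (closed_crocco_domain_inf X) w.
Definition d_xi (X : R) (w : point -> R) : point -> R :=
  pd Xi (closed_crocco_domain_inf X) w.
Definition d_eta (X : R) (w : point -> R) : point -> R :=
  pd Eta (closed_crocco_domain_inf X) w.
Definition d2_eta (X : R) (w : point -> R) : point -> R :=
  d_eta X (d_eta X w).

Definition crocco_solution (T X : R) (w0 w1 : R -> R -> R) (w : point -> R) :
    Prop :=
  (forall p, crocco_domain T X p ->
     - d_tau X w p - coord Eta p * d_xi X w p + (w p) ^ 2 * d2_eta X w p = 0) /\
  (forall t x, 0 <= t <= T -> 0 <= x <= X ->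
     w (t, x, 0) * d_eta X w (t, x, 0) = 0 /\ w (t, x, 1) = 0) /\
  (forall x e, 0 <= x <= X -> 0 <= e <= 1 -> w (0, x, e) = w0 x e) /\
  (forall t e, 0 <= t <= T -> 0 <= e <= 1 -> w (t, 0, e) = w1 t e).

(** [f] extends continuously to η = 1 with value [g]: the limit is taken in
    all three variables jointly. *)
Definition extends_at_eta1 (X : R) (f : point -> R) (g : R -> R -> R) : Prop :=
  forall t x, 0 <= t -> 0 <= x <= X ->
    filterlim f (within (closed_crocco_domain_inf X) (locally (t, x, 1)))
              (locally (g t x)).

Definition oleinik_monotone_solution (X : R) (w0 w1 : R -> R -> R)
    (w : point -> R) : Prop :=
  C_on 2 (closed_crocco_domain_inf X) w /\
  C_on 3 (crocco_domain_inf X) w /\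
  (forall T, 0 < T -> crocco_solution T X w0 w1 w) /\
  extends_at_eta1 X w (fun _ _ => 0) /\
  extends_at_eta1 X (d_xi X w) (fun _ _ => 0) /\
  extends_at_eta1 X (d_tau X w) (fun _ _ => 0) /\
  exists l : R -> R -> R,
    continuous_on (fun q : R * R => 0 <= fst q /\ 0 <= snd q <= X)
                  (fun q : R * R => l (fst q) (snd q)) /\
    extends_at_eta1 X (fun p => w p * d2_eta X w p) l.

(** Minimum of a continuous [f] on the interval [[a, b]], as an infimum. *)
Definition min_on (a b : R) (f : R -> R) : R :=
  real (Glb_Rbar (fun y => exists s, a <= s <= b /\ y = f s)).

(* Main.v *)
Require Import Defs.
From Stdlib Require Import Reals Lra Classical ClassicalEpsilon.
From Coquelicot Require Import Coquelicot.
Open Scope R_scope.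

(** Write s = 1 - η, u = ∂τ w, v = ∂ξ w + ∂τ w and q = w ∂η²w.  All bounds come
    from one maximum principle ([maximum_principle]) for ∂τ + η ∂ξ - a ∂η² with
    a >= 0, used through comparison with barriers a(ξ) k(η).

    The bounds on w use the Crocco equation as a linear equation with coefficient
    a = w².  Concavity makes the logarithmic profile a supersolution
    ([crocco_le_log_barrier]).  The lower barrier ([crocco_ge_barrier]) is
    convex near η = 0 and decays like e^{- βξ}; away from η = 0 the transport term
    η ∂ξ pays for its concavity, thanks to the upper bound on w, and this fixes β.
    The constant b is so small that w >= 2 b s, twice what is claimed.

    Differentiated along τ or ξ, the equation becomes
    ∂τ f + η ∂ξ f = w² ∂η²f + 2 q f, with ∂η f = 0 at η = 0; hence u and v solve it
    ([linearised_equation], [neumann_linearised]).  As long as q <= 2 δ, the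
    zero-order term is dominated: by - w² ∂η² acting on s^α0, since
    α0 (1 - α0) b² >= 10 δ ([linearised_le_power]), and for the upper bound on v by
    transport and concavity together acting on e^ξ s (2 + η)
    ([linearised_le_exp]).  So the bounds on u and v propagate from the data as
    long as q <= 2 δ.

    Conversely w q = s u + η v, so the bounds on u and v, with w >= 2 b s, give back
    the better bound q <= δ ([diffusion_of_tangential_bounds]).  Since q is
    continuous up to η = 1, a continuation argument in time ([bootstrap]) removes
    the assumption q <= 2 δ. *)

(** * Extrema on boxes *)

Lemma locally_point (t x e : R) (P : point -> Prop) :
  locally ((t, x, e) : point) P <->
  exists d, 0 < d /\ forall t' x' e',
    Rabs (t' - t) < d -> Rabs (x' - x) < d -> Rabs (e' - e) < d ->
    P (t', x', e').
Proof.
  split.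
  - intros [d Hd]. exists (pos d). split; [apply cond_pos|].
    intros t' x' e' Ht Hx He. apply Hd. repeat split; assumption.
  - intros [d [Hd H]]. exists (mkposreal d Hd).
    intros [[t' x'] e'] [[Ht Hx] He]. apply H; assumption.
Qed.

Definition box (T X : R) (p : point) : Prop :=
  let '(t, x, e) := p in 0 <= t <= T /\ 0 <= x <= X /\ 0 <= e <= 1.

(** The local bounds are fed to a Lebesgue-number form of compactness.  That form
    provides one uniform radius and not a finite subcover, so every point gets a
    radius no larger than the inverse of its local bound: a lower bound on the
    radii is then an upper bound on the function. *)
Lemma locally_bounded_box (T X : R) (g : point -> R) :
  (forall p, box T X p ->
     exists M, within (box T X) (locally p) (fun r => g r <= M)) ->
  exists M, forall p, box T X p -> g p <= M.
Proof.
  intros Hloc.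
  assert (Hd : forall p, exists d : posreal, box T X p -> forall r,
     box T X r -> close_n 3 d (fst (fst r), (snd (fst r), (snd r, tt)))
                              (fst (fst p), (snd (fst p), (snd p, tt))) ->
     g r <= / d).
  { intros [[t x] e].
    destruct (classic (box T X (t, x, e))) as [Hb|Hb].
    - destruct (Hloc _ Hb) as [M HM]. unfold within in HM.
      apply locally_point in HM. destruct HM as [d [d0 HM]].
      assert (Hm : 0 < / (1 + Rabs M)).
      { apply Rinv_0_lt_compat. generalize (Rabs_pos M); lra. }
      exists (mkposreal _ (Rmin_pos _ _ d0 Hm)). intros _ [[t' x'] e'] Hr.
      simpl. intros [Ht [Hx [He _]]].
      assert (Hl : Rmin d (/ (1 + Rabs M)) <= d) by apply Rmin_l.
      apply Rle_trans with M.
      + apply HM; trivial; lra.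
      + apply Rle_trans with (/ / (1 + Rabs M)).
        * rewrite Rinv_inv. generalize (Rle_abs M); lra.
        * apply Rinv_le_contravar; [apply Rmin_pos; assumption|apply Rmin_r].
    - exists (mkposreal 1 Rlt_0_1). intros H; contradiction. }
  destruct (ClassicalEpsilon.choice _ Hd) as [delta Hdelta].
  destruct (compactness_value 3 (0, (0, (0, tt))) (T, (X, (1, tt)))
    (fun s => let '(t, (x, (e, _))) := s in delta (t, x, e))) as [d H].
  exists (/ d). intros [[t x] e] Hp.
  apply NNPP. intros Hn.
  apply (H (t, (x, (e, tt)))).
  { simpl in *. tauto. }
  intros [[t' [x' [e' u]]] [Hb [Hc Hle]]]. apply Hn.
  apply Rle_trans with (/ delta (t', x', e')).
  - apply Hdelta; [simpl in *; tauto|assumption|].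
    destruct u. exact Hc.
  - apply Rinv_le_contravar; [apply cond_pos|assumption].
Qed.

(** If the supremum [M] of [g] were not attained, [/ (M - g)] would be locally
    bounded, hence bounded by some [C], and [M - / C] would bound [g]. *)
Lemma usc_box_max (T X : R) (g : point -> R) (p0 : point) :
  (forall p, box T X p -> forall eps, 0 < eps ->
     within (box T X) (locally p) (fun r => g r < g p + eps)) ->
  box T X p0 ->
  exists p, box T X p /\ forall r, box T X r -> g r <= g p.
Proof.
  intros Husc Hp0.
  destruct (locally_bounded_box T X g) as [M0 HM0].
  { intros p Hp. exists (g p + 1).
    generalize (Husc p Hp 1 Rlt_0_1). apply filter_imp.
    intros r Hr. left; exact Hr. }
  destruct (completeness (fun y => exists p, box T X p /\ y = g p))
    as [M [HMub HMl]].
  { exists M0. intros y [p [Hp ->]]. auto. }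
  { exists (g p0). exists p0. auto. }
  apply NNPP. intros Hno.
  assert (Hlt : forall p, box T X p -> g p < M).
  { intros p Hp. destruct (Rle_lt_or_eq_dec (g p) M) as [H|H]; trivial.
    - apply HMub. exists p; auto.
    - exfalso. apply Hno. exists p. split; trivial.
      intros r Hr. rewrite H. apply HMub. exists r; auto. }
  destruct (locally_bounded_box T X (fun p => / (M - g p))) as [C HC].
  { intros p Hp. exists (/ ((M - g p) / 2)).
    assert (H2 : 0 < (M - g p) / 2) by (specialize (Hlt p Hp); lra).
    generalize (Husc p Hp _ H2). apply filter_imp.
    intros r Hr. apply Rinv_le_contravar; lra. }
  assert (HC0 : 0 < C).
  { apply Rlt_le_trans with (2 := HC p0 Hp0). apply Rinv_0_lt_compat.
    specialize (Hlt p0 Hp0); lra. }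
  assert (HM : M <= M - / C).
  { apply HMl. intros y [p [Hp ->]].
    specialize (HC p Hp). specialize (Hlt p Hp).
    apply Rinv_le_contravar in HC; [|apply Rinv_0_lt_compat; lra].
    rewrite Rinv_inv in HC. lra. }
  apply Rinv_0_lt_compat in HC0. lra.
Qed.

(** * Derivatives at a maximum *)

Lemma is_derive_diff_quot (f : R -> R) (x l eps : R) :
  is_derive f x l -> 0 < eps ->
  exists d, 0 < d /\ forall h, h <> 0 -> Rabs h < d ->
    Rabs ((f (x + h) - f x) / h - l) < eps.
Proof.
  intros H He. apply is_derive_Reals in H.
  destruct (H eps He) as [d Hd]. exists d. split; [apply cond_pos|auto].
Qed.

(** One-sided maxima are what the maximum principle meets at the last time and
    on the outflow face of the box. *)
Lemma is_derive_left_max (f : R -> R) (x l a : R) :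
  is_derive f x l -> a < x -> (forall y, a <= y <= x -> f y <= f x) -> 0 <= l.
Proof.
  intros H Ha Hm. apply Rnot_lt_le. intros Hl.
  destruct (is_derive_diff_quot f x l (- l / 2) H) as [d [d0 Hd]]; [lra|].
  set (k := Rmin (d / 2) (x - a)).
  assert (k0 : 0 < k) by (apply Rmin_pos; lra).
  assert (k1 : k <= d / 2) by apply Rmin_l.
  assert (k2 : k <= x - a) by apply Rmin_r.
  assert (Hq := Hd (- k)). rewrite Rabs_Ropp, (Rabs_pos_eq k) in Hq by lra.
  specialize (Hq ltac:(lra) ltac:(lra)). apply Rabs_def2 in Hq.
  assert (Hf := Hm (x + - k) ltac:(lra)).
  assert (0 <= (f (x + - k) - f x) / - k).
  { replace ((f (x + - k) - f x) / - k) with ((f x - f (x + - k)) * / k)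
      by (field; lra).
    apply Rmult_le_pos; [lra|]. left; apply Rinv_0_lt_compat; lra. }
  lra.
Qed.

Lemma is_derive_interior_max (f : R -> R) (x l a b : R) :
  is_derive f x l -> a < x < b -> (forall y, a <= y <= b -> f y <= f x) ->
  l = 0.
Proof.
  intros H Ha Hm. apply Rle_antisym.
  - assert (H0 : 0 <= - l); [|lra].
    apply (is_derive_left_max (fun y => f (- y)) (- x) (- l) (- b)).
    + replace (- l) with (-1 * l) by ring.
      apply (is_derive_comp f (fun y => - y)).
      * rewrite Ropp_involutive. exact H.
      * auto_derive; trivial.
    + lra.
    + intros y Hy. rewrite Ropp_involutive. apply Hm; lra.
  - apply (is_derive_left_max f x l a); try lra; trivial.
    intros y Hy; apply Hm; lra.
Qed.

Lemma is_derive2_interior_max (f f1 : R -> R) (x l a b : R) :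
  locally x (fun y => is_derive f y (f1 y)) -> is_derive f1 x l ->
  a < x < b -> (forall y, a <= y <= b -> f y <= f x) -> l <= 0.
Proof.
  intros Hf H1 Hab Hm. apply Rnot_lt_le. intros Hl.
  assert (Hz : f1 x = 0).
  { apply (is_derive_interior_max f x (f1 x) a b); trivial.
    apply locally_singleton in Hf. exact Hf. }
  destruct Hf as [d1 Hf].
  destruct (is_derive_diff_quot f1 x l (l / 2) H1) as [d [d0 Hd]]; [lra|].
  set (k := Rmin (Rmin (d / 2) (d1 / 2)) (b - x)).
  assert (p1 := cond_pos d1).
  assert (k0 : 0 < k) by (repeat apply Rmin_pos; lra).
  assert (k1 : k <= d / 2) by (eapply Rle_trans; [apply Rmin_l|apply Rmin_l]).
  assert (k2 : k <= d1 / 2) by (eapply Rle_trans; [apply Rmin_l|apply Rmin_r]).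
  assert (k3 : k <= b - x) by apply Rmin_r.
  destruct (MVT_cor2 f f1 x (x + k)) as [c [Hmv Hc]]; [lra| |].
  { intros y Hy. apply is_derive_Reals, Hf.
    change (Rabs (y - x) < d1). rewrite Rabs_pos_eq; lra. }
  assert (Hq := Hd (c - x)). rewrite Rabs_pos_eq in Hq by lra.
  specialize (Hq ltac:(lra) ltac:(lra)). apply Rabs_def2 in Hq.
  replace (x + (c - x)) with c in Hq by ring. rewrite Hz in Hq.
  assert (Hc1 : 0 < f1 c).
  { replace (f1 c) with ((f1 c - 0) / (c - x) * (c - x)) by (field; lra).
    apply Rmult_lt_0_compat; lra. }
  assert (Hc2 : 0 < f1 c * (x + k - x)) by (apply Rmult_lt_0_compat; lra).
  specialize (Hm (x + k) ltac:(lra)). lra.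
Qed.

Lemma is_pd_eta0_max (X : R) (f : point -> R) (t x l : R) :
  0 <= t -> 0 <= x <= X ->
  is_pd Eta (closed_crocco_domain_inf X) f (t, x, 0) l ->
  (forall e, 0 <= e < 1 -> f (t, x, e) <= f (t, x, 0)) -> l <= 0.
Proof.
  intros Ht Hx H Hm. apply Rnot_lt_le. intros Hl.
  destruct (H l Hl) as [d [d0 Hd]]. simpl in Hd.
  set (k := Rmin (d / 2) (1 / 2)).
  assert (k0 : 0 < k) by (apply Rmin_pos; lra).
  assert (k1 : k <= d / 2) by apply Rmin_l.
  assert (k2 : k <= 1 / 2) by apply Rmin_r.
  specialize (Hd k). unfold R_dist, D_x, Rdist in Hd.
  rewrite Rminus_0_r, (Rabs_pos_eq k) in Hd by lra.
  specialize (Hd ltac:(repeat split; lra)).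
  apply Rabs_def2 in Hd.
  assert (0 <= (f (t, x, 0) - f (t, x, k)) * / k).
  { specialize (Hm k ltac:(lra)). apply Rmult_le_pos; [lra|].
    left; apply Rinv_0_lt_compat; lra. }
  unfold Rdiv in Hd. lra.
Qed.

(** * Continuity and traces at η = 1 *)

Lemma continuous_on_eps (S : point -> Prop) (f : point -> R) :
  continuous_on S f <->
  forall p, S p -> forall eps, 0 < eps ->
    within S (locally p) (fun r => Rabs (f r - f p) < eps).
Proof.
  split; intros H p Hp.
  - intros eps He. exact (proj1 (filterlim_locally f (f p)) (H p Hp)
             (mkposreal eps He)).
  - apply filterlim_locally. intros eps. exact (H p Hp eps (cond_pos eps)).
Qed.

Lemma extends_at_eta1_eps (X : R) (f : point -> R) (g : R -> R -> R) :
  extends_at_eta1 X f g <->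
  forall t x, 0 <= t -> 0 <= x <= X -> forall eps, 0 < eps ->
    within (closed_crocco_domain_inf X) (locally ((t, x, 1) : point))
      (fun r => Rabs (f r - g t x) < eps).
Proof.
  split; intros H t x Ht Hx.
  - intros eps He.
    exact (proj1 (filterlim_locally f (g t x)) (H t x Ht Hx)
             (mkposreal eps He)).
  - apply filterlim_locally. intros eps. exact (H t x Ht Hx eps (cond_pos eps)).
Qed.

Lemma continuous_coord (i : axis) (p : point) : continuous (coord i) p.
Proof.
  destruct p as [[t x] e]. apply filterlim_locally. intros eps.
  apply locally_point. exists eps. split; [apply cond_pos|].
  intros t' x' e' Ht Hx He. destruct i; assumption.
Qed.

Lemma continuous_on_mult (S : point -> Prop) (f g : point -> R) :
  continuous_on S f -> continuous_on S g ->
  continuous_on S (fun p => f p * g p).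
Proof.
  intros Hf Hg p Hp.
  eapply filterlim_comp_2; [exact (Hf p Hp)|exact (Hg p Hp)|].
  exact (filterlim_mult (K := R_AbsRing) (f p) (g p)).
Qed.

Lemma continuous_on_plus (S : point -> Prop) (f g : point -> R) :
  continuous_on S f -> continuous_on S g ->
  continuous_on S (fun p => f p + g p).
Proof.
  intros Hf Hg p Hp.
  eapply filterlim_comp_2; [exact (Hf p Hp)|exact (Hg p Hp)|].
  exact (filterlim_plus (V := R_NormedModule) (f p) (g p)).
Qed.

Lemma continuous_on_opp (S : point -> Prop) (f : point -> R) :
  continuous_on S f -> continuous_on S (fun p => - f p).
Proof.
  intros Hf p Hp.
  eapply filterlim_comp; [exact (Hf p Hp)|].
  exact (filterlim_opp (V := R_NormedModule) (f p)).
Qed.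

Lemma extends_at_eta1_plus (X : R) (f g : point -> R) (lf lg : R -> R -> R) :
  extends_at_eta1 X f lf -> extends_at_eta1 X g lg ->
  extends_at_eta1 X (fun p => f p + g p) (fun t x => lf t x + lg t x).
Proof.
  intros Hf Hg t x Ht Hx.
  eapply filterlim_comp_2; [exact (Hf t x Ht Hx)|exact (Hg t x Ht Hx)|].
  exact (filterlim_plus (V := R_NormedModule) (lf t x) (lg t x)).
Qed.

Lemma extends_at_eta1_opp (X : R) (f : point -> R) (lf : R -> R -> R) :
  extends_at_eta1 X f lf ->
  extends_at_eta1 X (fun p => - f p) (fun t x => - lf t x).
Proof.
  intros Hf t x Ht Hx.
  eapply filterlim_comp; [exact (Hf t x Ht Hx)|].
  exact (filterlim_opp (V := R_NormedModule) (lf t x)).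
Qed.

Lemma exp_nondecreasing (x y : R) : x <= y -> exp x <= exp y.
Proof.
  intros H. apply Rnot_lt_le. intros Hlt. apply exp_lt_inv in Hlt. lra.
Qed.

(** * Maximum principle *)

(** The derivatives that enter the Crocco operator.  Their values are arguments,
    so that the jets of solutions and barriers add up termwise; ∂η f is required
    near [e], where it is differentiated again. *)
Definition has_jet (f : point -> R) (t x e ft fx fee : R) : Prop :=
  is_derive (fun s => f (s, x, e)) t ft /\
  is_derive (fun s => f (t, s, e)) x fx /\
  exists fe : R -> R,
    locally e (fun s => is_derive (fun r => f (t, x, r)) s (fe s)) /\
    is_derive fe e fee.

Lemma continuous_on_pos_near (X : R) (z : point -> R) (t x e : R) :
  continuous_on (closed_crocco_domain_inf X) z ->
  closed_crocco_domain_inf X (t, x, e) -> 0 < z (t, x, e) ->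
  exists d, 0 < d /\ forall t' x' e',
    closed_crocco_domain_inf X (t', x', e') ->
    Rabs (t' - t) < d -> Rabs (x' - x) < d -> Rabs (e' - e) < d ->
    0 < z (t', x', e').
Proof.
  intros Hc HS Hz.
  assert (H := proj1 (continuous_on_eps _ _) Hc _ HS _ Hz).
  apply locally_point in H. destruct H as [d [d0 H]].
  exists d. split; trivial. intros t' x' e' HS' Ht Hx He.
  specialize (H t' x' e' Ht Hx He HS'). apply Rabs_def2 in H. lra.
Qed.

(** Maximum principle for the degenerate operator ∂τ + η ∂ξ - a ∂η².  After
    multiplication by exp (- λτ) with λ > Q, a positive maximum cannot be interior:
    there the first-order terms are nonnegative and the second-order term has the
    right sign, because η >= 0 and a >= 0.  The same holds on the face ξ = X and at
    the last time, where the field ∂τ + η ∂ξ points outwards.  At η = 0, where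
    the transport in ξ degenerates, either a strictly positive slope in η or
    control of ∂τ excludes the maximum; the second alternative serves the points
    of η = 0 where the solution itself might vanish.

    The argument is run for ξ < X, where all derivatives are two-sided, and the
    face ξ = X is reached by continuity. *)
Lemma maximum_principle (X T Q : R) (z : point -> R) :
  0 < X -> 0 <= Q ->
  continuous_on (closed_crocco_domain_inf X) z ->
  extends_at_eta1 X z (fun _ _ => 0) ->
  (forall t x e, closed_crocco_domain_inf X (t, x, e) -> t <= T ->
     t = 0 \/ x = 0 -> z (t, x, e) <= 0) ->
  (forall t x, 0 < t <= T -> 0 < x < X -> 0 < z (t, x, 0) ->
     (exists l, 0 < l /\
        is_pd Eta (closed_crocco_domain_inf X) z (t, x, 0) l) \/
     (exists zt, is_derive (fun s => z (s, x, 0)) t zt /\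
        zt <= Q * z (t, x, 0))) ->
  (forall t x e, 0 < t <= T -> 0 < x < X -> 0 < e < 1 -> 0 < z (t, x, e) ->
     exists a zt zx zee, 0 <= a /\ has_jet z t x e zt zx zee /\
       zt + e * zx - a * zee <= Q * z (t, x, e)) ->
  forall t x e, closed_crocco_domain_inf X (t, x, e) -> t <= T ->
    z (t, x, e) <= 0.
Proof.
  intros X0 Q0 Hc H1 Hdata Heta0 Hint.
  assert (Hin : forall t x e, closed_crocco_domain_inf X (t, x, e) ->
            t <= T -> x < X -> z (t, x, e) <= 0).
  { intros t0 x0 e0 HS HT HX. apply Rnot_lt_le. intros Hz.
    (* extended by 0 to η >= 1, g is upper semicontinuous on the closed box *)
    set (lam := Q + 1).
    set (g := fun p : point =>
       if Rlt_dec (coord Eta p) 1 then exp (- lam * coord Tau p) * z p else 0).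
    assert (Hexp : forall s, 0 < exp (- lam * s)) by (intros; apply exp_pos).
    destruct HS as [Ht0 [Hx0 He0]].
    assert (Hsub : forall t x e, box T x0 (t, x, e) -> e < 1 ->
              closed_crocco_domain_inf X (t, x, e)).
    { simpl. intros t x e Hb He. lra. }
    destruct (usc_box_max T x0 g (t0, x0, e0)) as [[[t x] e] [Hb Hm]].
    - intros [[t x] e] Hb eps Heps.
      destruct (Rlt_dec e 1) as [He|He].
      + assert (Hg : continuous_on (closed_crocco_domain_inf X)
                  (fun p => exp (- lam * coord Tau p) * z p)).
        { apply continuous_on_mult; trivial. apply continuous_on_forall.
          intros p _. apply continuous_comp; [|apply continuous_exp].
          apply (continuous_mult (fun _ => - lam) (coord Tau)).
          apply continuous_const. apply continuous_coord. }
        assert (Hl := proj1 (continuous_on_eps _ _) Hg _ (Hsub _ _ _ Hb He) _ Heps).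
        apply locally_point in Hl. destruct Hl as [d [d0 Hl]].
        apply locally_point. exists (Rmin d (1 - e)).
        split; [apply Rmin_pos; lra|]. intros t' x' e' Ht Hx Hee Hb'.
        assert (Rmin d (1 - e) <= d) by apply Rmin_l.
        assert (Rmin d (1 - e) <= 1 - e) by apply Rmin_r.
        apply Rabs_def2 in Hee.
        unfold g. simpl coord.
        destruct (Rlt_dec e' 1) as [He'|He']; [|lra].
        destruct (Rlt_dec e 1) as [_|He'']; [|lra].
        specialize (Hl t' x' e'). simpl coord in Hl.
        specialize (Hl ltac:(lra) ltac:(lra)
          ltac:(apply Rabs_def1; lra) (Hsub _ _ _ Hb' He')).
        apply Rabs_def2 in Hl. lra.
      + assert (e = 1) by (simpl in Hb; lra). subst e.
        assert (Hl := proj1 (extends_at_eta1_eps _ _ _) H1 t x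
          ltac:(simpl in Hb; lra) ltac:(simpl in Hb; lra) eps Heps).
        apply locally_point in Hl. destruct Hl as [d [d0 Hl]].
        apply locally_point. exists d. split; trivial.
        intros t' x' e' Ht Hx Hee Hb'.
        unfold g. simpl coord.
        destruct (Rlt_dec 1 1) as [He'|_]; [lra|].
        destruct (Rlt_dec e' 1) as [He'|He']; [|lra].
        specialize (Hl t' x' e' Ht Hx Hee (Hsub _ _ _ Hb' He')).
        apply Rabs_def2 in Hl. 
        assert (exp (- lam * t') <= 1).
        { rewrite <- exp_0. apply exp_nondecreasing. simpl in Hb'.
          assert (0 <= lam * t') by (apply Rmult_le_pos; unfold lam; lra). lra. }
        specialize (Hexp t').
        destruct (Rle_lt_dec (z (t', x', e')) 0) as [Hn|Hn].
        * assert (exp (- lam * t') * z (t', x', e') <= exp (- lam * t') * 0)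
            by (apply Rmult_le_compat_l; lra). lra.
        * assert (exp (- lam * t') * z (t', x', e') <= 1 * z (t', x', e'))
            by (apply Rmult_le_compat_r; lra). lra.
    - simpl; lra.
    - assert (Hp0 := Hm (t0, x0, e0) ltac:(simpl; lra)).
      assert (Hg0 : 0 < g (t0, x0, e0)).
      { unfold g. simpl coord. destruct (Rlt_dec e0 1); [|lra].
        apply Rmult_lt_0_compat; trivial. }
      assert (He : e < 1).
      { unfold g in Hp0 at 2. simpl coord in Hp0.
        destruct (Rlt_dec e 1); lra. }
      assert (Hge : forall t x e, e < 1 ->
                g (t, x, e) = exp (- lam * t) * z (t, x, e)).
      { intros t' x' e' He'. unfold g. simpl coord.
        destruct (Rlt_dec e' 1); [trivial|lra]. }
      assert (Hzp : 0 < z (t, x, e)).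
      { rewrite (Hge t x e He) in Hp0. apply Rnot_le_lt. intros Hn.
        assert (exp (- lam * t) * z (t, x, e) <= exp (- lam * t) * 0).
        { specialize (Hexp t). apply Rmult_le_compat_l; lra. }
        lra. }
      assert (HSp := Hsub _ _ _ Hb He).
      assert (Htx : 0 < t /\ 0 < x).
      { simpl in Hb. split; apply Rnot_le_lt; intros Hn.
        - assert (Hd := Hdata t x e HSp ltac:(lra) ltac:(left; lra)). lra.
        - assert (Hd := Hdata t x e HSp ltac:(lra) ltac:(right; lra)). lra. }
      assert (Hbt := Hb). simpl in Hbt.
      assert (Hslice : forall x' e', 0 <= x' <= x0 -> 0 <= e' < 1 ->
                z (t, x', e') <= z (t, x, e)).
      { intros x' e' Hx' He'. assert (H := Hm (t, x', e') ltac:(simpl; lra)).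
        rewrite !Hge in H by lra. apply Rmult_le_reg_l in H; trivial. }
      assert (Hgrow : forall zt, is_derive (fun s => z (s, x, e)) t zt ->
                lam * z (t, x, e) <= zt).
      { intros zt Hzt.
        assert (H := is_derive_left_max
          (fun s => exp (- lam * s) * z (s, x, e)) t
          (exp (- lam * t) * (zt - lam * z (t, x, e))) 0).
        assert (Hd : is_derive (fun s => exp (- lam * s) * z (s, x, e)) t
                  (exp (- lam * t) * (zt - lam * z (t, x, e)))).
        { replace (exp (- lam * t) * (zt - lam * z (t, x, e))) with
            ((- lam * exp (- lam * t)) * z (t, x, e) + exp (- lam * t) * zt)
            by ring.
          apply (is_derive_mult (fun s => exp (- lam * s)) (fun s => z (s, x, e)));
            [|exact Hzt|intros; apply Rmult_comm].
          auto_derive; trivial. ring. }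
        specialize (H Hd ltac:(lra)).
        assert (0 <= zt - lam * z (t, x, e)); [|lra].
        apply Rmult_le_reg_l with (exp (- lam * t)); trivial.
        rewrite Rmult_0_r. apply H. intros y Hy.
        assert (Hy' := Hm (y, x, e) ltac:(simpl; lra)).
        rewrite !Hge in Hy' by lra. exact Hy'. }
      assert (Hlz : Q * z (t, x, e) < lam * z (t, x, e)).
      { apply Rmult_lt_compat_r; unfold lam; lra. }
      destruct (Req_dec e 0) as [E0|E0].
      + subst e.
        destruct (Heta0 t x ltac:(lra) ltac:(lra) Hzp)
          as [[l [Hl Hpd]]|[zt [Hzt Hle]]].
        * apply is_pd_eta0_max in Hpd; [lra|lra|lra|].
          intros e' He'. apply Hslice; lra.
        * apply Hgrow in Hzt. lra.
      + destruct (Hint t x e ltac:(lra) ltac:(lra) ltac:(lra) Hzp)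
          as [a [zt [zx [zee [Ha [[Hzt [Hzx [ze [Hze Hzee]]]] Hle]]]]]].
        apply Hgrow in Hzt.
        apply (is_derive_left_max _ _ _ 0) in Hzx;
          [|lra|intros; apply Hslice; lra].
        apply (is_derive2_interior_max _ _ _ _ 0 ((e + 1) / 2) Hze) in Hzee;
          [|lra|intros; apply Hslice; lra].
        assert (0 <= e * zx) by (apply Rmult_le_pos; lra).
        assert (0 <= a * - zee) by (apply Rmult_le_pos; lra).
        lra. }
  intros t x e HS HT. apply Rnot_lt_le. intros Hz.
  destruct (Rlt_dec x X) as [Hx|Hx].
  - specialize (Hin t x e HS HT Hx). lra.
  - destruct (continuous_on_pos_near X z t x e Hc HS Hz) as [d [d0 Hd]].
    simpl in HS. set (k := Rmin (d / 2) (X / 2)).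
    assert (k0 : 0 < k) by (apply Rmin_pos; lra).
    assert (k1 : k <= d / 2) by apply Rmin_l.
    assert (k2 : k <= X / 2) by apply Rmin_r.
    assert (HS' : closed_crocco_domain_inf X (t, x - k, e)) by (simpl; lra).
    specialize (Hd _ _ _ HS'). specialize (Hin _ _ _ HS').
    rewrite (Rminus_diag t), (Rminus_diag e), Rabs_R0 in Hd.
    replace (x - k - x) with (- k) in Hd by ring.
    rewrite Rabs_Ropp, Rabs_pos_eq in Hd by lra.
    specialize (Hd d0 ltac:(lra) d0). specialize (Hin HT ltac:(lra)). lra.
Qed.

(** * Calculus of partial derivatives relative to a set *)

Lemma with_coord_coord (i : axis) (p : point) : with_coord i p (coord i p) = p.
Proof. destruct p as [[t x] e], i; reflexivity. Qed.

Lemma locally_with_coord (i : axis) (p : point) (P : point -> Prop) :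
  locally p P -> locally (coord i p) (fun s => P (with_coord i p s)).
Proof.
  destruct p as [[t x] e]. intros H. apply locally_point in H.
  destruct H as [d [d0 H]]. exists (mkposreal d d0). intros s Hs.
  change (Rabs (s - coord i (t, x, e)) < d) in Hs.
  destruct i; simpl in *; apply H; rewrite ?Rminus_diag, ?Rabs_R0; assumption.
Qed.

(** Derivatives relative to [A] in the direction [i] are unique at [p] only if the
    slice of [A] through [p] clusters at [p]. *)
Definition limit_point_along (A : point -> Prop) (i : axis) (p : point) : Prop :=
  adhDa (D_x (fun s => A (with_coord i p s)) (coord i p)) (coord i p).

Lemma limit_point_interior (A : point -> Prop) (i : axis) (p : point) :
  locally p A -> limit_point_along A i p.
Proof.
  intros H a Ha. apply (locally_with_coord i) in H. destruct H as [d Hd].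
  assert (p0 := cond_pos d).
  set (k := Rmin (d / 2) (a / 2)).
  assert (k0 : 0 < k) by (apply Rmin_pos; lra).
  assert (k1 : k <= d / 2) by apply Rmin_l.
  assert (k2 : k <= a / 2) by apply Rmin_r.
  exists (coord i p + k). unfold R_dist, Rdist.
  replace (coord i p + k - coord i p) with k by ring.
  rewrite Rabs_pos_eq by lra. split; [|lra]. split; [|lra].
  apply Hd. change (Rabs (coord i p + k - coord i p) < d).
  replace (coord i p + k - coord i p) with k by ring.
  rewrite Rabs_pos_eq; lra.
Qed.

Lemma pd_correct (A : point -> Prop) (i : axis) (f : point -> R)
    (p : point) (l : R) :
  limit_point_along A i p -> is_pd i A f p l ->
  pd i A f p = l.
Proof.
  intros Ha Hl. unfold pd, Derive_in.
  apply (iota_unique (V := R_CompleteNormedModule)); [|exact Hl].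
  intros y Hy. exact (single_limit _ _ _ _ _ Ha Hy Hl).
Qed.

Lemma is_derive_is_pd (A : point -> Prop) (i : axis) (f : point -> R)
    (p : point) (l : R) :
  is_derive (fun s => f (with_coord i p s)) (coord i p) l -> is_pd i A f p l.
Proof.
  rewrite is_derive_Reals. intros H eps He. destruct (H eps He) as [a H'].
  exists a. split; [apply cond_pos|]. simpl. unfold Rdist, D_x.
  intros x [[_ Hne] Hx]. specialize (H' (x - coord i p)).
  replace (coord i p + (x - coord i p)) with x in H' by ring.
  apply H'; trivial. intros E; apply Hne; lra.
Qed.

Lemma is_pd_is_derive (A : point -> Prop) (i : axis) (f : point -> R)
    (p : point) (l : R) :
  locally (coord i p) (fun s => A (with_coord i p s)) -> is_pd i A f p l ->
  is_derive (fun s => f (with_coord i p s)) (coord i p) l.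
Proof.
  intros [d Hd] H. apply is_derive_Reals. intros eps He.
  destruct (H eps He) as [a [Ha H']]. simpl in H'.
  assert (m0 : 0 < Rmin a d) by (apply Rmin_pos; [lra|apply cond_pos]).
  exists (mkposreal _ m0). intros h h0 Hh. simpl in Hh.
  assert (Rmin a d <= a) by apply Rmin_l.
  assert (Rmin a d <= d) by apply Rmin_r.
  specialize (H' (coord i p + h)). unfold Rdist, D_x in H'.
  replace (coord i p + h - coord i p) with h in H' by ring.
  apply H'. split; [split|lra]; [|intros E; apply h0; lra].
  apply Hd. change (Rabs (coord i p + h - coord i p) < d).
  replace (coord i p + h - coord i p) with h by ring. lra.
Qed.

Lemma pd_interior_unique (A : point -> Prop) (i : axis) (f : point -> R)
    (p : point) (l : R) :
  locally p A ->
  is_derive (fun s => f (with_coord i p s)) (coord i p) l -> pd i A f p = l.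
Proof.
  intros HA Hl. apply pd_correct; [apply limit_point_interior; exact HA|].
  apply is_derive_is_pd; assumption.
Qed.

Lemma C_on_continuous (n : nat) (A : point -> Prop) (f : point -> R) :
  C_on n A f -> continuous_on A f.
Proof. destruct n; intros [H _]; exact H. Qed.

Lemma C_on_le (n : nat) (A : point -> Prop) (f : point -> R) :
  C_on (S n) A f -> C_on n A f.
Proof.
  revert f. induction n as [|n IH]; intros f [Hc H].
  - split; trivial.
  - split; trivial. intros i. destruct (H i) as [He Hi]. split; trivial.
    apply IH. exact Hi.
Qed.

Lemma C_on_pd (n : nat) (A : point -> Prop) (f : point -> R) (i : axis) :
  C_on (S n) A f -> C_on n A (pd i A f).
Proof. intros [_ H]. apply (H i). Qed.

Lemma C_on_is_pd (n : nat) (A : point -> Prop) (f : point -> R) (i : axis)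
    (p : point) :
  C_on (S n) A f -> A p -> limit_point_along A i p -> is_pd i A f p (pd i A f p).
Proof.
  intros [_ H] Hp Ha. destruct (H i) as [He _]. destruct (He p Hp) as [l Hl].
  rewrite (pd_correct A i f p l); assumption.
Qed.

Lemma C_on_is_derive (n : nat) (A : point -> Prop) (f : point -> R) (i : axis)
    (p : point) :
  C_on (S n) A f -> locally p A ->
  is_derive (fun s => f (with_coord i p s)) (coord i p) (pd i A f p).
Proof.
  intros H HA.
  apply (is_pd_is_derive A); [exact (locally_with_coord i p A HA)|].
  apply (C_on_is_pd n); trivial.
  - apply locally_singleton in HA. exact HA.
  - apply limit_point_interior; trivial.
Qed.

Lemma pd_ext_loc (A B : point -> Prop) (f g : point -> R) (i : axis)
    (p : point) (l : R) :
  locally p A -> locally p B -> locally p (fun r => f r = g r) ->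
  is_derive (fun s => f (with_coord i p s)) (coord i p) l ->
  pd i A f p = pd i B g p.
Proof.
  intros HA HB Heq Hl. rewrite (pd_interior_unique A i f p l HA Hl).
  symmetry. apply pd_interior_unique; trivial.
  eapply is_derive_ext_loc; [|exact Hl].
  apply (locally_with_coord i) in Heq. exact Heq.
Qed.

Lemma locally_2d_with_coord (i j : axis) (p : point) (P : point -> Prop) :
  i <> j -> locally p P ->
  locally_2d (fun a b => P (with_coord j (with_coord i p a) b))
    (coord i p) (coord j p).
Proof.
  destruct p as [[t x] e]. intros Hij H. apply locally_point in H.
  destruct H as [d [d0 H]]. exists (mkposreal d d0). simpl pos.
  intros a b Ha Hb.
  destruct i, j; try (exfalso; apply Hij; reflexivity); simpl in *; apply H;
    rewrite ?Rminus_diag, ?Rabs_R0; assumption.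
Qed.

(** Schwarz's theorem, for the iterated partial derivatives relative to a set. *)
Lemma pd_comm (A : point -> Prop) (f : point -> R) (i j : axis) (p : point) :
  C_on 2 A f -> locally p A ->
  pd i A (pd j A f) p = pd j A (pd i A f) p.
Proof.
  intros Hf HA.
  assert (Hij : {i = j} + {i <> j}) by decide equality.
  destruct Hij as [<-|Hij]; [reflexivity|].
  set (P := fun a b => with_coord j (with_coord i p a) b).
  assert (Pi : forall a b s, with_coord i (P a b) s = P s b).
  { intros a b s. unfold P. destruct p as [[t x] e].
    destruct i, j; try reflexivity; exfalso; apply Hij; reflexivity. }
  assert (Pj : forall a b s, with_coord j (P a b) s = P a s).
  { intros a b s. unfold P. destruct p as [[t x] e].
    destruct i, j; reflexivity. }
  assert (Ci : forall a b, coord i (P a b) = a).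
  { intros a b. unfold P. destruct p as [[t x] e].
    destruct i, j; try reflexivity; exfalso; apply Hij; reflexivity. }
  assert (Cj : forall a b, coord j (P a b) = b).
  { intros a b. unfold P. destruct p as [[t x] e].
    destruct i, j; reflexivity. }
  assert (Pp : P (coord i p) (coord j p) = p).
  { unfold P. rewrite with_coord_coord.
    apply with_coord_coord. }
  assert (HAA : forall a b, locally (P a b) A ->
            locally (P a b) (fun r => locally r A)).
  { intros a b H. apply locally_locally. exact H. }
  assert (Di : forall n h a b, C_on (S n) A h -> locally (P a b) A ->
     is_derive (fun s => h (P s b)) a (pd i A h (P a b))).
  { intros n h a b Hh Hl.
    assert (H := C_on_is_derive n A h i (P a b) Hh Hl). rewrite Ci in H.
    eapply is_derive_ext; [|exact H]. intros s. cbv beta.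
    rewrite Pi. reflexivity. }
  assert (Dj : forall n h a b, C_on (S n) A h -> locally (P a b) A ->
     is_derive (fun s => h (P a s)) b (pd j A h (P a b))).
  { intros n h a b Hh Hl.
    assert (H := C_on_is_derive n A h j (P a b) Hh Hl). rewrite Cj in H.
    eapply is_derive_ext; [|exact H]. intros s. cbv beta.
    rewrite Pj. reflexivity. }
  assert (Li : forall a b, locally (P a b) A ->
            locally a (fun s => locally (P s b) A)).
  { intros a b H. apply HAA, (locally_with_coord i) in H. rewrite Ci in H.
    revert H. apply filter_imp. intros s. rewrite Pi. trivial. }
  assert (Lj : forall a b, locally (P a b) A ->
            locally b (fun s => locally (P a s) A)).
  { intros a b H. apply HAA, (locally_with_coord j) in H. rewrite Cj in H.
    revert H. apply filter_imp. intros s. rewrite Pj. trivial. }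
  assert (Dij : forall a b, locally (P a b) A ->
     is_derive (fun z => Derive (fun t => f (P z t)) b) a
       (pd i A (pd j A f) (P a b))).
  { intros a b H. eapply is_derive_ext_loc; [|apply (Di 0%nat)].
    - generalize (Li a b H). apply filter_imp. intros s Hs.
      symmetry. apply is_derive_unique. apply (Dj 1%nat); assumption.
    - apply C_on_pd; assumption.
    - exact H. }
  assert (Dji : forall a b, locally (P a b) A ->
     is_derive (fun z => Derive (fun t => f (P t z)) a) b
       (pd j A (pd i A f) (P a b))).
  { intros a b H. eapply is_derive_ext_loc; [|apply (Dj 0%nat)].
    - generalize (Lj a b H). apply filter_imp. intros s Hs.
      symmetry. apply is_derive_unique. apply (Di 1%nat); assumption.
    - apply C_on_pd; assumption.
    - exact H. }
  assert (HA2 : locally_2d (fun a b => locally (P a b) A) (coord i p) (coord j p)).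
  { apply (locally_2d_with_coord i j p (fun r => locally r A)); trivial.
    apply locally_locally. exact HA. }
  assert (Hcont : forall k l (D2 : R -> R -> R), 
     (forall a b, locally (P a b) A -> D2 a b = pd k A (pd l A f) (P a b)) ->
     continuity_2d_pt D2 (coord i p) (coord j p)).
  { intros k l D2 HD eps.
    assert (Hc : continuous_on A (pd k A (pd l A f))).
    { apply (C_on_continuous 0). apply C_on_pd, C_on_pd. exact Hf. }
    assert (He := proj1 (continuous_on_eps _ _) Hc p
       ltac:(apply locally_singleton in HA; exact HA) eps (cond_pos eps)).
    assert (He' : locally p (fun r => Rabs (pd k A (pd l A f) r
                     - pd k A (pd l A f) p) < eps)).
    { generalize (filter_and _ _ HA He). apply filter_imp.
      intros r [Hr Hr']. exact (Hr' Hr). }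
    apply (locally_2d_with_coord i j) in He'; trivial.
    destruct HA2 as [d1 H1]. destruct He' as [d2 H2].
    assert (m0 : 0 < Rmin d1 d2) by (apply Rmin_pos; apply cond_pos).
    exists (mkposreal _ m0). simpl. intros a b Ha Hb.
    assert (Rmin d1 d2 <= d1) by apply Rmin_l.
    assert (Rmin d1 d2 <= d2) by apply Rmin_r.
    rewrite !HD, Pp.
    - apply H2; lra.
    - rewrite Pp. exact HA.
    - apply H1; lra. }
  assert (HS := Schwarz (fun a b => f (P a b)) (coord i p) (coord j p)).
  cbv beta in HS.
  assert (Hp : locally (P (coord i p) (coord j p)) A) by (rewrite Pp; exact HA).
  assert (E1 := is_derive_unique _ _ _ (Dij _ _ Hp)).
  assert (E2 := is_derive_unique _ _ _ (Dji _ _ Hp)).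
  rewrite Pp in E1, E2. rewrite <- E1, <- E2. apply HS.
  - destruct HA2 as [d1 H1]. exists d1. intros a b Ha Hb.
    specialize (H1 a b Ha Hb). repeat split; eexists.
    + apply (Di 1%nat); assumption.
    + apply (Dj 1%nat); assumption.
    + apply Dij; assumption.
    + apply Dji; assumption.
  - apply (Hcont i j). intros a b H. apply is_derive_unique. apply Dij, H.
  - apply (Hcont j i). intros a b H. apply is_derive_unique. apply Dji, H.
Qed.

(** * Interior and boundary points of the Crocco domain *)

(** The points around which all partial derivatives are two-sided; the face
    ξ = X, which belongs to [crocco_domain_inf], is left out. *)
Definition interior_domain (X : R) (p : point) : Prop :=
  let '(t, x, e) := p in 0 < t /\ 0 < x < X /\ 0 < e < 1.

Lemma locally_interior_domain (X : R) (p : point) :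
  interior_domain X p -> locally p (interior_domain X).
Proof.
  destruct p as [[t x] e]. intros [Ht [Hx He]]. apply locally_point.
  set (d := Rmin t (Rmin (Rmin x (X - x)) (Rmin e (1 - e)))).
  exists d. split; [repeat apply Rmin_pos; lra|].
  assert (d1 : d <= t) by apply Rmin_l.
  assert (d2 : d <= Rmin (Rmin x (X - x)) (Rmin e (1 - e))) by apply Rmin_r.
  assert (d3 := Rmin_l (Rmin x (X - x)) (Rmin e (1 - e))).
  assert (d4 := Rmin_r (Rmin x (X - x)) (Rmin e (1 - e))).
  assert (d5 := Rmin_l x (X - x)).
  assert (d6 := Rmin_r x (X - x)).
  assert (d7 := Rmin_l e (1 - e)).
  assert (d8 := Rmin_r e (1 - e)).
  intros t' x' e' Ht' Hx' He'.
  apply Rabs_def2 in Ht'. apply Rabs_def2 in Hx'. apply Rabs_def2 in He'.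
  simpl. lra.
Qed.

Lemma locally_closed_domain (X : R) (p : point) :
  interior_domain X p -> locally p (closed_crocco_domain_inf X).
Proof.
  intros Hp. generalize (locally_interior_domain X p Hp). apply filter_imp.
  intros [[t x] e] H. simpl in *. lra.
Qed.

Lemma locally_open_domain (X : R) (p : point) :
  interior_domain X p -> locally p (crocco_domain_inf X).
Proof.
  intros Hp. generalize (locally_interior_domain X p Hp). apply filter_imp.
  intros [[t x] e] H. simpl in *. lra.
Qed.

Lemma interior_domain_dense (X : R) (f : point -> R) :
  0 < X -> continuous_on (closed_crocco_domain_inf X) f ->
  (forall p, interior_domain X p -> f p = 0) ->
  forall p, closed_crocco_domain_inf X p -> f p = 0.
Proof.
  intros X0 Hc H0 p Hp. apply NNPP. intros Hn.
  assert (Ha : 0 < Rabs (f p)) by (apply Rabs_pos_lt; exact Hn).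
  assert (He := proj1 (continuous_on_eps _ _) Hc p Hp _ Ha).
  destruct p as [[t x] e]. apply locally_point in He.
  destruct He as [d [d0 He]]. simpl in Hp.
  set (k := Rmin (d / 2) (Rmin (X / 4) ((1 - e) / 2))).
  assert (k0 : 0 < k) by (repeat apply Rmin_pos; lra).
  assert (k1 : k <= d / 2) by apply Rmin_l.
  assert (k' : k <= Rmin (X / 4) ((1 - e) / 2)) by apply Rmin_r.
  assert (Rmin (X / 4) ((1 - e) / 2) <= X / 4) by apply Rmin_l.
  assert (Rmin (X / 4) ((1 - e) / 2) <= (1 - e) / 2) by apply Rmin_r.
  set (x' := if Rlt_dec x (X / 2) then x + k else x - k).
  assert (Hx' : 0 < x' < X /\ Rabs (x' - x) < d).
  { unfold x'. destruct (Rlt_dec x (X / 2)).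
    - split; [lra|]. apply Rabs_def1; lra.
    - split; [lra|]. apply Rabs_def1; lra. }
  specialize (He (t + k) x' (e + k)
    ltac:(apply Rabs_def1; lra) ltac:(lra) ltac:(apply Rabs_def1; lra)
    ltac:(simpl; lra)).
  cbv beta in He. rewrite (H0 (t + k, x', e + k)) in He by (simpl; lra).
  rewrite Rminus_0_l, Rabs_Ropp in He. lra.
Qed.

Lemma limit_point_closed_domain (X : R) (i : axis) (p : point) :
  0 < X -> closed_crocco_domain_inf X p ->
  limit_point_along (closed_crocco_domain_inf X) i p.
Proof.
  intros X0 Hp a Ha. destruct p as [[t x] e]. simpl in Hp.
  set (k := Rmin (a / 2) (Rmin (X / 4) ((1 - e) / 2))).
  assert (k0 : 0 < k) by (repeat apply Rmin_pos; lra).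
  assert (k1 : k <= a / 2) by apply Rmin_l.
  assert (k' : k <= Rmin (X / 4) ((1 - e) / 2)) by apply Rmin_r.
  assert (Rmin (X / 4) ((1 - e) / 2) <= X / 4) by apply Rmin_l.
  assert (Rmin (X / 4) ((1 - e) / 2) <= (1 - e) / 2) by apply Rmin_r.
  unfold D_x, R_dist, Rdist. destruct i; simpl.
  - exists (t + k). repeat split; try lra. apply Rabs_def1; lra.
  - destruct (Rlt_dec x (X / 2)).
    + exists (x + k). repeat split; try lra. apply Rabs_def1; lra.
    + exists (x - k). repeat split; try lra. apply Rabs_def1; lra.
  - exists (e + k). repeat split; try lra. apply Rabs_def1; lra.
Qed.

(** * Derivatives of the Crocco equation *)

Lemma has_jet_of_C_on (A : point -> Prop) (f : point -> R) (t x e : R) :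
  C_on 2 A f -> locally ((t, x, e) : point) A ->
  has_jet f t x e (pd Tau A f (t, x, e)) (pd Xi A f (t, x, e))
    (pd Eta A (pd Eta A f) (t, x, e)).
Proof.
  intros Hf HA. split; [|split].
  - exact (C_on_is_derive 1 A f Tau (t, x, e) Hf HA).
  - exact (C_on_is_derive 1 A f Xi (t, x, e) Hf HA).
  - exists (fun s => pd Eta A f (t, x, s)). split.
    + assert (HL := locally_locally _ _ HA).
      apply (locally_with_coord Eta) in HL. revert HL. apply filter_imp.
      intros s Hs. exact (C_on_is_derive 1 A f Eta (t, x, s) Hf Hs).
    + exact (C_on_is_derive 0 A _ Eta (t, x, e) (C_on_pd 1 A f Eta Hf) HA).
Qed.

Lemma has_jet_ext_loc (f g : point -> R) (t x e ft fx fee : R) :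
  locally ((t, x, e) : point) (fun r => f r = g r) ->
  has_jet f t x e ft fx fee -> has_jet g t x e ft fx fee.
Proof.
  intros H [Ht [Hx [fe [He Hee]]]]. split; [|split].
  - eapply is_derive_ext_loc; [|exact Ht].
    exact (locally_with_coord Tau _ _ H).
  - eapply is_derive_ext_loc; [|exact Hx].
    exact (locally_with_coord Xi _ _ H).
  - exists fe. split; trivial.
    assert (HL := locally_with_coord Eta _ _ H).
    apply locally_locally in HL.
    generalize (filter_and _ _ He HL). apply filter_imp.
    intros s [Hs Hl]. eapply is_derive_ext_loc; [|exact Hs]. exact Hl.
Qed.

Lemma has_jet_plus (f g : point -> R) (t x e ft fx fee gt gx gee : R) :
  has_jet f t x e ft fx fee -> has_jet g t x e gt gx gee ->
  has_jet (fun p => f p + g p) t x e (ft + gt) (fx + gx) (fee + gee).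
Proof.
  intros [Hft [Hfx [fe [Hfe Hfee]]]] [Hgt [Hgx [ge [Hge Hgee]]]].
  split; [|split].
  - exact (is_derive_plus _ _ _ _ _ Hft Hgt).
  - exact (is_derive_plus _ _ _ _ _ Hfx Hgx).
  - exists (fun s => fe s + ge s). split.
    + generalize (filter_and _ _ Hfe Hge). apply filter_imp.
      intros s [H1 H2]. exact (is_derive_plus _ _ _ _ _ H1 H2).
    + exact (is_derive_plus _ _ _ _ _ Hfee Hgee).
Qed.

Lemma has_jet_opp (f : point -> R) (t x e ft fx fee : R) :
  has_jet f t x e ft fx fee ->
  has_jet (fun p => - f p) t x e (- ft) (- fx) (- fee).
Proof.
  intros [Hft [Hfx [fe [Hfe Hfee]]]]. split; [|split].
  - exact (is_derive_opp _ _ _ Hft).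
  - exact (is_derive_opp _ _ _ Hfx).
  - exists (fun s => - fe s). split.
    + revert Hfe. apply filter_imp. intros s H1.
      exact (is_derive_opp _ _ _ H1).
    + exact (is_derive_opp _ _ _ Hfee).
Qed.

Lemma is_pd_plus (i : axis) (A : point -> Prop) (f g : point -> R) (p : point)
    (l m : R) :
  is_pd i A f p l -> is_pd i A g p m -> is_pd i A (fun r => f r + g r) p (l + m).
Proof.
  intros Hf Hg.
  exact (Dadd (fun s => A (with_coord i p s)) (fun _ => l) (fun _ => m)
     (fun s => f (with_coord i p s)) (fun s => g (with_coord i p s)) _ Hf Hg).
Qed.

Lemma is_pd_opp (i : axis) (A : point -> Prop) (f : point -> R) (p : point)
    (l : R) :
  is_pd i A f p l -> is_pd i A (fun r => - f r) p (- l).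
Proof.
  intros Hf.
  exact (Dopp (fun s => A (with_coord i p s)) 
     (fun s => f (with_coord i p s)) (fun _ => l) _ Hf).
Qed.

(** The chain rule for w² ∂η²w - ∂τ w - η ∂ξ w along a line parallel to the τ or
    ξ axis, where [k] stands for the constant value of η. *)
Lemma derive_crocco_slice (a b c d : R -> R) (k s a' b' c' d' : R) :
  is_derive a s a' -> is_derive b s b' -> is_derive c s c' ->
  is_derive d s d' ->
  locally s (fun r => a r ^ 2 * b r - c r - k * d r = 0) ->
  2 * a s * a' * b s + a s ^ 2 * b' - c' - k * d' = 0.
Proof.
  intros Ha Hb Hc Hd H0.
  assert (H : is_derive (fun r => a r ^ 2 * b r - c r - k * d r) s
            (2 * a s * a' * b s + a s ^ 2 * b' - c' - k * d')).
  { auto_derive.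
    - repeat split; eexists; eassumption.
    - rewrite (is_derive_unique (fun x : R => a x) _ _ Ha),
        (is_derive_unique (fun x : R => b x) _ _ Hb),
        (is_derive_unique (fun x : R => c x) _ _ Hc),
        (is_derive_unique (fun x : R => d x) _ _ Hd). ring. }
  apply (is_derive_ext_loc _ (fun _ => 0)) in H; [|exact H0].
  rewrite <- (is_derive_unique _ _ _ H). apply Derive_const.
Qed.

(** What the argument uses of an Oleinik monotone solution, apart from the data
    and from the trace of w ∂η²w at η = 1. *)
Record crocco_classical (X : R) (w : point -> R) : Prop := {
  cc_X : 0 < X;
  cc_C2 : C_on 2 (closed_crocco_domain_inf X) w;
  cc_C3 : C_on 3 (crocco_domain_inf X) w;
  cc_eq : forall p, crocco_domain_inf X p ->
     - d_tau X w p - coord Eta p * d_xi X w p + (w p) ^ 2 * d2_eta X w p = 0;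
  cc_eta0 : forall t x, 0 <= t -> 0 <= x <= X ->
     w (t, x, 0) * d_eta X w (t, x, 0) = 0;
  cc_w1 : extends_at_eta1 X w (fun _ _ => 0);
  cc_dxi1 : extends_at_eta1 X (d_xi X w) (fun _ _ => 0);
  cc_dtau1 : extends_at_eta1 X (d_tau X w) (fun _ _ => 0)
}.

(** All terms are continuous up to the faces, so the equation persists there; on
    η = 0 it reads ∂τ w = w² ∂η²w. *)
Lemma crocco_equation_closed (X : R) (w : point -> R) (p : point) :
  crocco_classical X w ->
  closed_crocco_domain_inf X p ->
  d_tau X w p + coord Eta p * d_xi X w p = (w p) ^ 2 * d2_eta X w p.
Proof.
  intros Hw Hp.
  assert (H := interior_domain_dense X
    (fun p => d_tau X w p + coord Eta p * d_xi X w p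
       + - ((w p) ^ 2 * d2_eta X w p)) (cc_X _ _ Hw)).
  cbv beta in H. apply Rminus_diag_uniq. apply H; trivial.
  - assert (C2 := cc_C2 _ _ Hw).
    assert (Cw := C_on_continuous _ _ _ C2).
    apply continuous_on_plus; [apply continuous_on_plus|].
    + exact (C_on_continuous 1 _ _ (C_on_pd 1 _ _ Tau C2)).
    + apply continuous_on_mult.
      * apply continuous_on_forall. intros r _. apply continuous_coord.
      * exact (C_on_continuous 1 _ _ (C_on_pd 1 _ _ Xi C2)).
    + apply continuous_on_opp. apply continuous_on_mult.
      * simpl. apply continuous_on_mult; trivial. apply continuous_on_mult; trivial.
        apply continuous_on_forall. intros r _. apply continuous_const.
      * exact (C_on_continuous 0 _ _ (C_on_pd 0 _ _ Eta (C_on_pd 1 _ _ Eta C2))).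
  - intros r Hr.
    assert (E := cc_eq _ _ Hw r).
    assert (Hs : crocco_domain_inf X r).
    { destruct r as [[t x] e]. simpl in *. lra. }
    specialize (E Hs). lra.
Qed.

Lemma has_jet_solution (X : R) (w : point -> R) (t x e : R) :
  crocco_classical X w ->
  interior_domain X (t, x, e) ->
  has_jet w t x e (d_tau X w (t, x, e)) (d_xi X w (t, x, e))
    (d2_eta X w (t, x, e)).
Proof.
  intros Hw Hp. apply (has_jet_of_C_on (closed_crocco_domain_inf X)).
  - exact (cc_C2 _ _ Hw).
  - apply locally_closed_domain; trivial.
Qed.

(** Derivatives of order at most two are continuous relative to the closed
    domain, those of order three relative to the open one; this lemma and the next
    identify the two families of derivatives where both are two-sided. *)
Lemma pd_closed_open (X : R) (w : point -> R) (i : axis) (p : point) :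
  crocco_classical X w ->
  interior_domain X p ->
  pd i (closed_crocco_domain_inf X) w p = pd i (crocco_domain_inf X) w p.
Proof.
  intros Hw Hp.
  set (S := closed_crocco_domain_inf X) in *.
  set (Sd := crocco_domain_inf X) in *.
  eapply pd_ext_loc.
  - apply locally_closed_domain; trivial.
  - apply locally_open_domain; trivial.
  - apply filter_forall. reflexivity.
  - apply (C_on_is_derive 1 S). exact (cc_C2 _ _ Hw).
    apply locally_closed_domain; trivial.
Qed.

Lemma pd2_closed_open (X : R) (w : point -> R) (i j : axis) (p : point) :
  crocco_classical X w ->
  interior_domain X p ->
  pd j (closed_crocco_domain_inf X) (pd i (closed_crocco_domain_inf X) w) p =
  pd j (crocco_domain_inf X) (pd i (crocco_domain_inf X) w) p.
Proof.
  intros Hw Hp.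
  set (S := closed_crocco_domain_inf X) in *.
  set (Sd := crocco_domain_inf X) in *.
  eapply pd_ext_loc.
  - apply locally_closed_domain; trivial.
  - apply locally_open_domain; trivial.
  - generalize (locally_interior_domain X p Hp). apply filter_imp.
    intros r Hr. apply (pd_closed_open X w _ _ Hw); trivial.
  - apply (C_on_is_derive 0 S). 
    + exact (C_on_pd 1 _ _ i (cc_C2 _ _ Hw)).
    + apply locally_closed_domain; trivial.
Qed.

(** Differentiating the equation along τ or ξ, neither of which occurs in its
    coefficients, gives for f = ∂τ w and f = ∂ξ w the same linear equation
    ∂τ f + η ∂ξ f = w² ∂η²f + 2 (w ∂η²w) f. *)
Lemma linearised_equation (X : R) (w : point -> R) (i : axis) (t x e : R) :
  crocco_classical X w ->
  i <> Eta -> interior_domain X (t, x, e) ->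
  exists ft fx fee, 
    has_jet (pd i (closed_crocco_domain_inf X) w) t x e ft fx fee /\
    ft + e * fx = w (t, x, e) ^ 2 * fee
      + 2 * (w (t, x, e) * d2_eta X w (t, x, e)) *
        pd i (closed_crocco_domain_inf X) w (t, x, e).
Proof.
  intros Hw Hi Hp.
  set (S := closed_crocco_domain_inf X) in *.
  set (Sd := crocco_domain_inf X) in *.
  assert (HA := locally_open_domain X _ Hp).
  assert (C3 := cc_C3 _ _ Hw). fold Sd in HA, C3.
  assert (C2 := C_on_le 2 _ _ C3).
  set (p := (t, x, e)) in *.
  exists (pd Tau Sd (pd i Sd w) p), (pd Xi Sd (pd i Sd w) p),
    (pd Eta Sd (pd Eta Sd (pd i Sd w)) p). split.
  - apply (has_jet_ext_loc (pd i Sd w)).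
    + generalize (locally_interior_domain X p Hp). apply filter_imp.
      intros r Hr. symmetry. apply (pd_closed_open X w _ _ Hw); trivial.
    + apply has_jet_of_C_on; trivial. exact (C_on_pd 2 _ _ i C3).
  - assert (Hee : pd i Sd (pd Eta Sd (pd Eta Sd w)) p
               = pd Eta Sd (pd Eta Sd (pd i Sd w)) p).
    { rewrite pd_comm; trivial; [|exact (C_on_pd 2 _ _ Eta C3)].
      eapply pd_ext_loc; trivial.
      - generalize (locally_locally _ _ HA). apply filter_imp.
        intros r Hr. apply pd_comm; trivial.
      - apply (C_on_is_derive 0 Sd); trivial.
        exact (C_on_pd 1 _ _ i (C_on_pd 2 _ _ Eta C3)). }
    rewrite (pd_comm Sd w Tau i p C2 HA), (pd_comm Sd w Xi i p C2 HA), <- Hee.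
    unfold d2_eta, d_eta. fold S.
    rewrite (pd2_closed_open X w _ _ _ Hw), (pd_closed_open X w _ _ Hw)
      by trivial.
    assert (D := derive_crocco_slice
       (fun s => w (with_coord i p s))
       (fun s => pd Eta Sd (pd Eta Sd w) (with_coord i p s))
       (fun s => pd Tau Sd w (with_coord i p s))
       (fun s => pd Xi Sd w (with_coord i p s)) e (coord i p)
       _ _ _ _
       (C_on_is_derive 2 Sd w i p C3 HA)
       (C_on_is_derive 0 Sd _ i p (C_on_pd 1 _ _ Eta (C_on_pd 2 _ _ Eta C3)) HA)
       (C_on_is_derive 1 Sd _ i p (C_on_pd 2 _ _ Tau C3) HA)
       (C_on_is_derive 1 Sd _ i p (C_on_pd 2 _ _ Xi C3) HA)).
    cbv beta in D. rewrite with_coord_coord in D.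
    fold Sd. lapply D; [intros D0; lra|].
    assert (HL := locally_interior_domain X p Hp).
    apply (locally_with_coord i) in HL. revert HL. apply filter_imp.
    intros s Hs.
    assert (E := crocco_equation_closed X w (with_coord i p s) Hw).
    unfold d2_eta, d_eta, d_tau, d_xi in E. fold S in E.
    rewrite (pd2_closed_open X w _ _ _ Hw), !(pd_closed_open X w _ _ Hw) in E
      by trivial.
    fold Sd in E.
    replace (coord Eta (with_coord i p s)) with e in E.
    + rewrite <- E; [ring|].
      generalize (locally_closed_domain X _ Hs). apply locally_singleton.
    + destruct i; simpl; trivial. exfalso; apply Hi; trivial.
Qed.

(** Where w > 0, the condition w ∂η w = 0 at η = 0 becomes ∂η w = 0, which can be
    differentiated along the face; ∂η commutes with the tangential derivative up
    to the face by continuity of the mixed derivatives. *)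
Lemma neumann_linearised (X : R) (w : point -> R) (i : axis) (t x : R) :
  crocco_classical X w ->
  i <> Eta -> 0 < t -> 0 < x < X -> 0 < w (t, x, 0) ->
  is_pd Eta (closed_crocco_domain_inf X) (pd i (closed_crocco_domain_inf X) w)
    (t, x, 0) 0.
Proof.
  intros Hw Hi Ht Hx Hpos.
  set (S := closed_crocco_domain_inf X) in *.
  assert (X0 := cc_X _ _ Hw). assert (C2 := cc_C2 _ _ Hw). fold S in C2.
  assert (Hp : S (t, x, 0)) by (simpl; lra).
  destruct (continuous_on_pos_near X w t x 0 (C_on_continuous _ _ _ C2) Hp Hpos)
    as [d [d0 Hd]].
  assert (Z : forall s, Rabs (s - coord i (t, x, 0)) < d ->
     S (with_coord i (t, x, 0) s) ->
     pd Eta S w (with_coord i (t, x, 0) s) = 0).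
  { intros s Hs HS.
    assert (Zp : forall t' x', S (t', x', 0) -> Rabs (t' - t) < d ->
              Rabs (x' - x) < d -> pd Eta S w (t', x', 0) = 0).
    { intros t' x' HS' Ht' Hx'.
      specialize (Hd t' x' 0 HS' Ht' Hx' ltac:(rewrite Rminus_diag, Rabs_R0; lra)).
      simpl in HS'.
      destruct (Rmult_integral _ _ (cc_eta0 _ _ Hw t' x' ltac:(lra) ltac:(lra)));
        [lra|assumption]. }
    destruct i; simpl in *.
    - apply Zp; trivial. rewrite Rminus_diag, Rabs_R0; lra.
    - apply Zp; trivial. rewrite Rminus_diag, Rabs_R0; lra.
    - exfalso; apply Hi; trivial. }
  assert (E : pd Eta S (pd i S w) (t, x, 0) = 0).
  { assert (Ec : pd Eta S (pd i S w) (t, x, 0) = pd i S (pd Eta S w) (t, x, 0)).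
    { apply Rminus_diag_uniq.
      apply (interior_domain_dense X
        (fun r => pd Eta S (pd i S w) r + - pd i S (pd Eta S w) r)); trivial.
      - apply continuous_on_plus; [|apply continuous_on_opp].
        + exact (C_on_continuous 0 _ _ (C_on_pd 0 _ _ Eta (C_on_pd 1 _ _ i C2))).
        + exact (C_on_continuous 0 _ _ (C_on_pd 0 _ _ i (C_on_pd 1 _ _ Eta C2))).
      - intros r Hr. rewrite (pd_comm S w Eta i r); trivial; [ring|].
        apply locally_closed_domain; trivial. }
    rewrite Ec. apply pd_correct; [apply limit_point_closed_domain; trivial|].
    intros eps Heps. exists d. split; [lra|].
    intros s [[Hs Hne] Hsd].
    change (Rabs ((pd Eta S w (with_coord i (t, x, 0) s)
      - pd Eta S w (with_coord i (t, x, 0) (coord i (t, x, 0))))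
      / (s - coord i (t, x, 0)) - 0) < eps).
    rewrite Z by assumption.
    rewrite Z by (rewrite ?with_coord_coord, ?Rminus_diag, ?Rabs_R0; assumption).
    unfold Rdiv. rewrite Rminus_diag, Rmult_0_l, Rminus_diag, Rabs_R0. lra. }
  assert (H := C_on_is_pd 0 S (pd i S w) Eta (t, x, 0) (C_on_pd 1 _ _ i C2) Hp
    (limit_point_closed_domain X Eta _ X0 Hp)).
  rewrite E in H. exact H.
Qed.

(** * Comparison with separable barriers *)

(** All barriers have this form; the lower bounds are upper bounds on the opposite
    functions. *)
Definition separable (a k : R -> R) (p : point) : R :=
  a (coord Xi p) * k (coord Eta p).

Definition vanishes_at_1 (k : R -> R) : Prop :=
  forall eps, 0 < eps -> exists d, 0 < d /\
    forall e, 1 - d < e < 1 -> Rabs (k e) < eps.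

Lemma separable_continuous (a k : R -> R) (p : point) :
  continuous a (coord Xi p) -> continuous k (coord Eta p) ->
  continuous (separable a k) p.
Proof.
  intros Ha Hk. apply (continuous_mult (fun p => a (coord Xi p))
    (fun p => k (coord Eta p))).
  - apply continuous_comp; [apply continuous_coord|exact Ha].
  - apply continuous_comp; [apply continuous_coord|exact Hk].
Qed.

Lemma separable_continuous_on (X : R) (a k : R -> R) :
  (forall x, continuous a x) -> (forall e, -1 < e < 1 -> continuous k e) ->
  continuous_on (closed_crocco_domain_inf X) (separable a k).
Proof.
  intros Ha Hk p Hp.
  eapply filterlim_filter_le_1; [apply filter_le_within|].
  apply separable_continuous; [apply Ha|apply Hk].
  destruct p as [[t x] e]. simpl in *. lra.
Qed.

Lemma separable_extends (X : R) (a k : R -> R) :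
  (forall x, continuous a x) -> vanishes_at_1 k ->
  extends_at_eta1 X (separable a k) (fun _ _ => 0).
Proof.
  intros Ha Hk. apply extends_at_eta1_eps. intros t x Ht Hx eps Heps.
  destruct (proj1 (filterlim_locally a (a x)) (Ha x) (mkposreal 1 Rlt_0_1))
    as [d1 H1].
  set (M := 1 + Rabs (a x)).
  assert (M0 : 0 < M) by (unfold M; generalize (Rabs_pos (a x)); lra).
  destruct (Hk (eps / M)) as [d2 [d20 H2]].
  { apply Rdiv_lt_0_compat; trivial. }
  apply locally_point. exists (Rmin d1 d2).
  split; [apply Rmin_pos; [apply cond_pos|trivial]|].
  assert (m1 := Rmin_l d1 d2). assert (m2 := Rmin_r d1 d2).
  intros t' x' e' Ht' Hx' He' HS. simpl in HS.
  assert (Hax : Rabs (a x' - a x) < 1).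
  { apply H1. change (Rabs (x' - x) < d1). lra. }
  assert (HaM : Rabs (a x') < M).
  { unfold M. replace (a x') with ((a x' - a x) + a x) by ring.
    eapply Rle_lt_trans; [apply Rabs_triang|]. lra. }
  apply Rabs_def2 in He'. specialize (H2 e' ltac:(lra)).
  unfold separable. simpl coord. rewrite Rminus_0_r, Rabs_mult.
  replace eps with (M * (eps / M)) by (field; lra).
  apply Rmult_le_0_lt_compat; trivial; apply Rabs_pos.
Qed.

(** The maximum principle applied to [f - a(ξ) k(η)]. *)
Lemma comparison (X T Q : R) (f : point -> R) (a a1 k k1 k2 : R -> R) :
  0 < X -> 0 <= Q ->
  continuous_on (closed_crocco_domain_inf X) f ->
  extends_at_eta1 X f (fun _ _ => 0) ->
  (forall x, is_derive a x (a1 x)) ->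
  (forall e, -1 < e < 1 -> is_derive k e (k1 e) /\ is_derive k1 e (k2 e)) ->
  vanishes_at_1 k ->
  (forall t x e, closed_crocco_domain_inf X (t, x, e) -> t <= T ->
     t = 0 \/ x = 0 -> f (t, x, e) <= a x * k e) ->
  (forall t x, 0 < t <= T -> 0 < x < X -> a x * k 0 < f (t, x, 0) ->
     (exists l, is_pd Eta (closed_crocco_domain_inf X) f (t, x, 0) l /\
        a x * k1 0 < l) \/
     (exists ft, is_derive (fun s => f (s, x, 0)) t ft /\
        ft <= Q * (f (t, x, 0) - a x * k 0))) ->
  (forall t x e, t <= T -> interior_domain X (t, x, e) ->
     a x * k e < f (t, x, e) ->
     exists A ft fx fee, 0 <= A /\ has_jet f t x e ft fx fee /\
       ft + e * (fx - a1 x * k e) - A * (fee - a x * k2 e)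
         <= Q * (f (t, x, e) - a x * k e)) ->
  forall t x e, closed_crocco_domain_inf X (t, x, e) -> t <= T ->
    f (t, x, e) <= a x * k e.
Proof.
  intros X0 Q0 Hc H1 Ha Hk Hk0 Hdata Heta0 Hint t x e HS HT.
  assert (Ca : forall x, continuous a x).
  { intros y. apply (ex_derive_continuous a). exists (a1 y). apply Ha. }
  assert (Ck : forall e, -1 < e < 1 -> continuous k e).
  { intros y Hy. apply (ex_derive_continuous k). exists (k1 y).
    apply (proj1 (Hk y Hy)). }
  assert (H := maximum_principle X T Q (fun p => f p + - separable a k p) X0 Q0).
  cbv beta in H.
  assert (f (t, x, e) + - separable a k (t, x, e) <= 0);
    [|unfold separable in *; simpl in *; lra].
  apply H; clear H; trivial.
  - apply continuous_on_plus; trivial. apply continuous_on_opp.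
    apply separable_continuous_on; trivial.
  - assert (E := extends_at_eta1_plus X _ _ _ _ H1
      (extends_at_eta1_opp X _ _ (separable_extends X a k Ca Hk0))).
    cbv beta in E. intros t' x' Ht' Hx'. specialize (E t' x' Ht' Hx').
    replace (0 + - 0) with 0 in E by ring. exact E.
  - intros t' x' e' HS' HT' Hd. specialize (Hdata t' x' e' HS' HT' Hd).
    unfold separable. simpl coord. lra.
  - intros t' x' Ht' Hx' Hz. unfold separable in Hz. simpl coord in Hz.
    destruct (Heta0 t' x' Ht' Hx' ltac:(lra)) as [[l [Hl Hlt]]|[ft [Hft Hle]]].
    + left. exists (l + - (a x' * k1 0)). split; [lra|].
      apply is_pd_plus; trivial. apply is_pd_opp, is_derive_is_pd.
      unfold separable. simpl.
      apply (is_derive_scal k 0 (a x') (k1 0)). apply Hk; lra.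
    + right. exists ft. unfold separable. simpl coord. split; [|lra].
      replace ft with (ft + 0) by ring.
      apply (is_derive_plus (fun s => f (s, x', 0)) (fun _ => - (a x' * k 0)));
        trivial.
      apply (is_derive_const (K := R_AbsRing) (V := R_NormedModule)).
  - intros t' x' e' Ht' Hx' He' Hz. unfold separable in Hz. simpl coord in Hz.
    destruct (Hint t' x' e' ltac:(lra) ltac:(simpl; lra) ltac:(lra))
      as [A [ft [fx [fee [HA [Hj Hle]]]]]].
    exists A, (ft + - 0), (fx + - (a1 x' * k e')), (fee + - (a x' * k2 e')).
    split; trivial. split.
    + apply has_jet_plus; trivial. apply has_jet_opp.
      unfold separable. split; [|split].
      * exact (is_derive_const (V := R_NormedModule) (a x' * k e') t').
      * apply (is_derive_ext (fun s => k e' * a s)).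
        { intros s. simpl. ring. }
        rewrite Rmult_comm.
        exact (is_derive_scal a x' (k e') (a1 x') (Ha x')).
      * exists (fun s => a x' * k1 s). split.
        -- assert (Hn : locally e' (fun s => -1 < s < 1)).
           { exists (mkposreal (Rmin e' (1 - e'))
               ltac:(apply Rmin_pos; lra)). intros s Hs.
             change (Rabs (s - e') < Rmin e' (1 - e')) in Hs.
             assert (m1 := Rmin_l e' (1 - e')). assert (m2 := Rmin_r e' (1 - e')).
             apply Rabs_def2 in Hs. lra. }
           revert Hn. apply filter_imp. intros s Hs.
           apply (is_derive_scal k s (a x') (k1 s)). apply Hk; trivial.
        -- apply (is_derive_scal k1 e' (a x') (k2 e')). apply Hk; lra.
    + unfold separable. simpl coord. lra.
Qed.

(** Both ∂τ w and ∂ξ w have this property, and it is linear in [f]; so it holds of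
    every function to which a barrier is compared once w > 0 on η = 0.  The
    boundary condition is asked for only up to the time [T] until which w is known
    to be positive. *)
Definition linearised (X T : R) (w f : point -> R) : Prop :=
  continuous_on (closed_crocco_domain_inf X) f /\
  extends_at_eta1 X f (fun _ _ => 0) /\
  (forall t x e, interior_domain X (t, x, e) ->
     exists ft fx fee, has_jet f t x e ft fx fee /\
       ft + e * fx = w (t, x, e) ^ 2 * fee
         + 2 * (w (t, x, e) * d2_eta X w (t, x, e)) * f (t, x, e)) /\
  (forall t x, 0 < t <= T -> 0 < x < X ->
     is_pd Eta (closed_crocco_domain_inf X) f (t, x, 0) 0).

Lemma linearised_plus (X T : R) (w f g : point -> R) :
  linearised X T w f -> linearised X T w g -> linearised X T w (fun p => f p + g p).
Proof.
  intros [Cf [Ef [Jf Nf]]] [Cg [Eg [Jg Ng]]]. split; [|split; [|split]].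
  - apply continuous_on_plus; trivial.
  - assert (E := extends_at_eta1_plus X _ _ _ _ Ef Eg).
    cbv beta in E. intros t' x' Ht' Hx'. specialize (E t' x' Ht' Hx').
    rewrite Rplus_0_r in E. exact E.
  - intros t x e Hp.
    destruct (Jf t x e Hp) as [ft [fx [fee [Hf E]]]].
    destruct (Jg t x e Hp) as [gt [gx [gee [Hg E']]]].
    exists (ft + gt), (fx + gx), (fee + gee). split.
    + apply has_jet_plus; trivial.
    + lra.
  - intros t x Ht Hx. rewrite <- (Rplus_0_r 0) at 2.
    apply is_pd_plus; auto.
Qed.

Lemma linearised_opp (X T : R) (w f : point -> R) :
  linearised X T w f -> linearised X T w (fun p => - f p).
Proof.
  intros [Cf [Ef [Jf Nf]]]. split; [|split; [|split]].
  - apply continuous_on_opp; trivial.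
  - assert (E := extends_at_eta1_opp X _ _ Ef).
    cbv beta in E. intros t' x' Ht' Hx'. specialize (E t' x' Ht' Hx').
    rewrite Ropp_0 in E. exact E.
  - intros t x e Hp.
    destruct (Jf t x e Hp) as [ft [fx [fee [Hf E]]]].
    exists (- ft), (- fx), (- fee). split.
    + apply has_jet_opp; trivial.
    + lra.
  - intros t x Ht Hx. rewrite <- Ropp_0 at 2.
    apply is_pd_opp; auto.
Qed.

(** A barrier for the linearised equation need only be a supersolution with slope
    negative at η = 0, because [f] has slope 0 there. *)
Lemma linearised_le (X T Q : R) (w f : point -> R) (a a1 k k1 k2 : R -> R) :
  0 < X -> 0 <= Q -> linearised X T w f ->
  (forall p, coord Tau p <= T -> interior_domain X p ->
     2 * (w p * d2_eta X w p) <= Q) ->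
  (forall x, is_derive a x (a1 x)) ->
  (forall e, -1 < e < 1 -> is_derive k e (k1 e) /\ is_derive k1 e (k2 e)) ->
  vanishes_at_1 k ->
  (forall t x e, closed_crocco_domain_inf X (t, x, e) -> t <= T ->
     t = 0 \/ x = 0 -> f (t, x, e) <= a x * k e) ->
  (forall x, a x * k1 0 < 0) ->
  (forall t x e, t <= T -> interior_domain X (t, x, e) ->
     2 * (w (t, x, e) * d2_eta X w (t, x, e)) * (a x * k e)
       <= e * (a1 x * k e) - w (t, x, e) ^ 2 * (a x * k2 e)) ->
  forall t x e, closed_crocco_domain_inf X (t, x, e) -> t <= T ->
    f (t, x, e) <= a x * k e.
Proof.
  intros X0 Q0 [Cf [Ef [Jf Nf]]] HQ Ha Hk Hk0 Hdata Hslope Hsuper.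
  apply (comparison X T Q f a a1 k k1 k2); trivial.
  - intros t x Ht Hx _. left. exists 0. split; auto.
  - intros t x e HT Hp Hlt.
    destruct (Jf t x e Hp) as [ft [fx [fee [Hf E]]]].
    exists (w (t, x, e) ^ 2), ft, fx, fee. split; [apply pow2_ge_0|].
    split; trivial.
    specialize (Hsuper t x e HT Hp). specialize (HQ (t, x, e) HT Hp).
    apply Rle_trans with (2 * (w (t, x, e) * d2_eta X w (t, x, e))
                            * (f (t, x, e) - a x * k e)); [lra|].
    apply Rmult_le_compat_r; lra.
Qed.

(** * Bounds on w *)

Lemma vanishes_at_1_lipschitz (k : R -> R) (M : R) :
  0 < M -> (forall e, -1 < e < 1 -> Rabs (k e) <= M * (1 - e)) ->
  vanishes_at_1 k.
Proof.
  intros M0 H eps Heps. exists (Rmin 1 (eps / M)).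
  split; [apply Rmin_pos; [lra|apply Rdiv_lt_0_compat; trivial]|].
  assert (m1 := Rmin_l 1 (eps / M)). assert (m2 := Rmin_r 1 (eps / M)).
  intros e He. apply Rle_lt_trans with (1 := H e ltac:(lra)).
  replace eps with (M * (eps / M)) by (field; lra).
  apply Rmult_lt_compat_l; lra.
Qed.

(** The barriers are ε (1 - η) for - w.  A point of η = 0 where w < 0 has
    ∂η w = 0, which is more than the slope - ε of the barrier. *)
Lemma crocco_nonneg (X T : R) (w : point -> R) :
  crocco_classical X w ->
  (forall t x e, closed_crocco_domain_inf X (t, x, e) -> t <= T ->
     t = 0 \/ x = 0 -> 0 <= w (t, x, e)) ->
  forall t x e, closed_crocco_domain_inf X (t, x, e) -> t <= T ->
    0 <= w (t, x, e).
Proof.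
  intros Hw Hdata t x e HS HT.
  assert (C2 := cc_C2 _ _ Hw). assert (X0 := cc_X _ _ Hw).
  apply Rnot_lt_le. intros Hneg.
  (* the bound by eps (1 - η) is violated at the supposed point *)
  set (eps := - w (t, x, e) / 2).
  assert (H : - w (t, x, e) <= eps * (1 - e)).
  { apply (comparison X T 0 (fun p => - w p) (fun _ => eps) (fun _ => 0)
      (fun e => 1 - e) (fun _ => -1) (fun _ => 0)); trivial; try lra.
    - apply continuous_on_opp. exact (C_on_continuous _ _ _ C2).
    - assert (E := extends_at_eta1_opp X _ _ (cc_w1 _ _ Hw)).
      cbv beta in E. intros t' x' Ht' Hx'. specialize (E t' x' Ht' Hx').
      rewrite Ropp_0 in E. exact E.
    - intros x'. apply (is_derive_const (V := R_NormedModule)).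
    - intros e' _. split.
      + auto_derive; trivial; ring.
      + apply (is_derive_const (V := R_NormedModule)).
    - apply (vanishes_at_1_lipschitz _ 1); [lra|].
      intros e' He'. rewrite Rabs_pos_eq; lra.
    - intros t' x' e' HS' HT' Hd. specialize (Hdata t' x' e' HS' HT' Hd).
      simpl in HS'. assert (0 <= eps * (1 - e')); [|lra].
      apply Rmult_le_pos; unfold eps; lra.
    - intros t' x' Ht' Hx' Hlt. left.
      assert (eps0 : 0 < eps) by (unfold eps; lra).
      assert (HS' : closed_crocco_domain_inf X (t', x', 0)) by (simpl; lra).
      exists (- d_eta X w (t', x', 0)). split.
      + apply is_pd_opp. apply (C_on_is_pd 1); trivial.
        apply limit_point_closed_domain; trivial.
      + destruct (Rmult_integral _ _ (cc_eta0 _ _ Hw t' x' ltac:(lra) ltac:(lra)))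
          as [E|E]; rewrite E in *; lra.
    - intros t' x' e' HT' Hp Hlt.
      assert (HS' : closed_crocco_domain_inf X (t', x', e')) by (simpl in *; lra).
      assert (E := crocco_equation_closed X w _ Hw HS'). simpl coord in E.
      exists (w (t', x', e') ^ 2), (- d_tau X w (t', x', e')),
        (- d_xi X w (t', x', e')), (- d2_eta X w (t', x', e')).
      split; [apply pow2_ge_0|]. split.
      + apply has_jet_opp. apply has_jet_solution; trivial.
      + lra. }
  simpl in HS.
  assert (eps * (1 - e) <= eps * 1) by
    (apply Rmult_le_compat_l; unfold eps; lra).
  unfold eps in *. lra.
Qed.

Lemma ln_barrier_pos (mu e : R) :
  0 < mu < 1 / 100 -> -1 < e < 1 ->
  1 < - ln (mu * (1 - e)) <= / (mu * (1 - e)).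
Proof.
  intros Hmu He.
  assert (Hy : 0 < mu * (1 - e)) by (apply Rmult_lt_0_compat; lra).
  assert (Hy2 : mu * (1 - e) < 1 / 50) by nra.
  split.
  - assert (ln (mu * (1 - e)) < -1); [|lra].
    rewrite <- (ln_exp (-1)). apply ln_increasing; trivial.
    apply Rlt_le_trans with (/ 3); [lra|].
    replace (exp (-1)) with (/ exp 1) by
      (rewrite <- exp_Ropp; f_equal; lra).
    apply Rinv_le_contravar; [apply exp_pos|apply exp_le_3].
  - rewrite <- ln_Rinv by trivial.
    set (z := / (mu * (1 - e))).
    assert (z0 : 0 < z) by (apply Rinv_0_lt_compat; trivial).
    assert (H := exp_ineq1_le (ln z)). rewrite exp_ln in H by trivial. lra.
Qed.

Lemma is_derive_log_barrier (mu e : R) :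
  0 < mu < 1 / 100 -> -1 < e < 1 ->
  let s := sqrt (- ln (mu * (1 - e))) in
  is_derive (fun e => (1 - e) * sqrt (- ln (mu * (1 - e)))) e
    (- s + / (2 * s)) /\
  is_derive (fun e => - sqrt (- ln (mu * (1 - e)))
       + / (2 * sqrt (- ln (mu * (1 - e))))) e
    (- (/ (2 * s) + / (4 * s ^ 3)) / (1 - e)).
Proof.
  intros Hmu He s.
  destruct (ln_barrier_pos mu e Hmu He) as [HL _].
  assert (Hy : 0 < mu * (1 - e)) by (apply Rmult_lt_0_compat; lra).
  assert (Hs : 0 < s) by (apply sqrt_lt_R0; lra).
  assert (Hs2 : s * s = - ln (mu * (1 - e))) by (apply sqrt_sqrt; lra).
  split.
  - auto_derive.
    + replace (1 + - e) with (1 - e) by ring. repeat split; lra.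
    + replace (1 + - e) with (1 - e) by ring. fold s. field. lra.
  - auto_derive.
    + replace (1 + - e) with (1 - e) by ring. fold s. repeat split; lra.
    + replace (1 + - e) with (1 - e) by ring. fold s. field. lra.
Qed.

(** From - ln y <= / y; this also makes the logarithmic barrier vanish at η = 1. *)
Lemma sqr_log_barrier (mu e : R) :
  0 < mu < 1 / 100 -> -1 < e < 1 ->
  ((1 - e) * sqrt (- ln (mu * (1 - e)))) ^ 2 <= (1 - e) / mu.
Proof.
  intros Hmu He. destruct (ln_barrier_pos mu e Hmu He) as [HL HU].
  rewrite Rpow_mult_distr. rewrite pow2_sqrt by lra.
  apply Rle_trans with ((1 - e) ^ 2 * / (mu * (1 - e))).
  - apply Rmult_le_compat_l; [apply pow2_ge_0|exact HU].
  - right. field. lra.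
Qed.

(** (1 - η) sqrt (- ln (μ (1 - η))) is a steady supersolution whatever the
    coefficient w²: it is concave in η, and decreasing at η = 0. *)
Lemma crocco_le_log_barrier (X T c0 mu : R) (w : point -> R) :
  0 < c0 -> 0 < mu < 1 / 100 ->
  crocco_classical X w ->
  (forall t x e, closed_crocco_domain_inf X (t, x, e) -> t <= T ->
     t = 0 \/ x = 0 ->
     w (t, x, e) <= / c0 * (1 - e) * sqrt (- ln (mu * (1 - e)))) ->
  forall t x e, closed_crocco_domain_inf X (t, x, e) -> t <= T ->
    w (t, x, e) <= / c0 * (1 - e) * sqrt (- ln (mu * (1 - e))).
Proof.
  intros Hc0 Hmu Hw Hdata t x e HS HT. rewrite Rmult_assoc.
  assert (C2 := cc_C2 _ _ Hw). assert (X0 := cc_X _ _ Hw).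
  assert (Hic : 0 < / c0) by (apply Rinv_0_lt_compat; trivial).
  assert (Hs : forall e, -1 < e < 1 -> 1 < sqrt (- ln (mu * (1 - e)))).
  { intros e' He'. apply Rle_lt_trans with (sqrt 1); [rewrite sqrt_1; lra|].
    apply sqrt_lt_1_alt.
    generalize (ln_barrier_pos mu e' Hmu He'). lra. }
  apply (comparison X T 0 w (fun _ => / c0) (fun _ => 0)
      (fun e => (1 - e) * sqrt (- ln (mu * (1 - e)))) 
      (fun e => - sqrt (- ln (mu * (1 - e)))
         + / (2 * sqrt (- ln (mu * (1 - e)))))
      (fun e => - (/ (2 * sqrt (- ln (mu * (1 - e))))
         + / (4 * sqrt (- ln (mu * (1 - e))) ^ 3)) / (1 - e)));
    trivial; try lra.
  - exact (C_on_continuous _ _ _ C2).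
  - exact (cc_w1 _ _ Hw).
  - intros x'. apply (is_derive_const (V := R_NormedModule)).
  - intros e' He'. apply is_derive_log_barrier; trivial.
  - intros eps Heps. exists (Rmin 1 (mu * eps ^ 2)).
    assert (E2 : 0 < eps ^ 2) by (apply pow_lt; trivial).
    split; [apply Rmin_pos; [lra|apply Rmult_lt_0_compat; lra]|].
    assert (m1 := Rmin_l 1 (mu * eps ^ 2)).
    assert (m2 := Rmin_r 1 (mu * eps ^ 2)).
    intros e' He'. rewrite <- (Rabs_pos_eq eps) by lra.
    apply Rsqr_lt_abs_0. rewrite !Rsqr_pow2.
    eapply Rle_lt_trans; [apply sqr_log_barrier; lra|].
    apply Rmult_lt_reg_r with mu; [lra|].
    replace ((1 - e') / mu * mu) with (1 - e') by (field; lra). lra.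
  - intros t' x' e' HS' HT' Hd. specialize (Hdata t' x' e' HS' HT' Hd). lra.
  - intros t' x' Ht' Hx' Hlt. left.
    assert (HS' : closed_crocco_domain_inf X (t', x', 0)) by (simpl; lra).
    specialize (Hs 0 ltac:(lra)).
    set (s := sqrt (- ln (mu * (1 - 0)))) in *.
    exists (d_eta X w (t', x', 0)). split.
    + apply (C_on_is_pd 1); trivial. apply limit_point_closed_domain; trivial.
    + assert (0 < / c0 * ((1 - 0) * s)) by
        (apply Rmult_lt_0_compat; [trivial|lra]).
      assert (/ (2 * s) < s).
      { apply Rlt_trans with 1; [|trivial].
        rewrite <- Rinv_1. apply Rinv_lt_contravar; lra. }
      assert (/ c0 * (- s + / (2 * s)) < / c0 * 0) by
        (apply Rmult_lt_compat_l; lra).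
      destruct (Rmult_integral _ _ (cc_eta0 _ _ Hw t' x' ltac:(lra) ltac:(lra)))
          as [E|E]; lra.
  - intros t' x' e' HT' Hp Hlt.
    assert (HS' : closed_crocco_domain_inf X (t', x', e')) by (simpl in *; lra).
    assert (E := crocco_equation_closed X w _ Hw HS'). simpl coord in E.
    exists (w (t', x', e') ^ 2), (d_tau X w (t', x', e')),
        (d_xi X w (t', x', e')), (d2_eta X w (t', x', e')).
    split; [apply pow2_ge_0|]. split.
    + apply has_jet_solution; trivial.
    + simpl in Hp. specialize (Hs e' ltac:(lra)).
      set (s := sqrt (- ln (mu * (1 - e')))) in *.
      assert (0 <= w (t', x', e') ^ 2 *
        (/ c0 * ((/ (2 * s) + / (4 * s ^ 3)) / (1 - e'))));
        [|unfold Rdiv in *; lra].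
      apply Rmult_le_pos; [apply pow2_ge_0|].
      assert (0 < / (2 * s)) by (apply Rinv_0_lt_compat; lra).
      assert (0 < / (4 * s ^ 3)).
      { apply Rinv_0_lt_compat. assert (0 < s ^ 3) by (apply pow_lt; lra). lra. }
      apply Rmult_le_pos; [lra|]. apply Rmult_le_pos; [lra|].
      left. apply Rinv_0_lt_compat. lra.
Qed.

(** The barrier is (c0 / 7) e^{- βξ} (1 - η) (1 + 2η + 4η²).  The cubic increases at
    η = 0, as the boundary condition requires, and is convex for η <= 1/6.  For
    η >= 1/6, up to the common exponential factor, its concavity costs at most 20 w², which is at most
    20 (1 - η) / (c0² μ) by the upper bound on w and is absorbed by the transport
    term β η (1 - η) when β = 120 / (c0² μ).  The factor 1 / 7 is the inverse of the
    maximum of 1 + 2η + 4η². *)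
Lemma crocco_ge_barrier (X T c0 mu : R) (w : point -> R) :
  0 < c0 < 1 -> 0 < mu < 1 / 100 ->
  crocco_classical X w ->
  (forall t x e, closed_crocco_domain_inf X (t, x, e) -> t <= T ->
     t = 0 \/ x = 0 -> c0 * (1 - e) <= w (t, x, e)) ->
  (forall t x e, closed_crocco_domain_inf X (t, x, e) -> t <= T ->
     0 <= w (t, x, e) <= / c0 * (1 - e) * sqrt (- ln (mu * (1 - e)))) ->
  forall t x e, closed_crocco_domain_inf X (t, x, e) -> t <= T ->
    c0 / 7 * exp (- (120 / (c0 ^ 2 * mu)) * X) * (1 - e) <= w (t, x, e).
Proof.
  intros Hc0 Hmu Hw Hdata Hbd t x e HS HT.
  set (beta := 120 / (c0 ^ 2 * mu)).
  assert (C2 := cc_C2 _ _ Hw). assert (X0 := cc_X _ _ Hw).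
  assert (Hcm : 0 < c0 ^ 2 * mu).
  { apply Rmult_lt_0_compat; [apply pow_lt|]; lra. }
  assert (Hb : 0 < beta) by (apply Rdiv_lt_0_compat; lra).
  assert (Hexp : forall x, 0 < c0 / 7 * exp (- beta * x)).
  { intros y. apply Rmult_lt_0_compat; [lra|apply exp_pos]. }
  assert (H : - w (t, x, e) <=
     - (c0 / 7 * exp (- beta * x)) * ((1 - e) * (1 + 2 * e + 4 * e ^ 2))).
  { apply (comparison X T 0 (fun p => - w p)
      (fun x => - (c0 / 7 * exp (- beta * x)))
      (fun x => beta * (c0 / 7 * exp (- beta * x)))
      (fun e => (1 - e) * (1 + 2 * e + 4 * e ^ 2))
      (fun e => 1 + 4 * e - 12 * e ^ 2) (fun e => 4 - 24 * e));
      trivial; try lra.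
    - apply continuous_on_opp. exact (C_on_continuous _ _ _ C2).
    - assert (E := extends_at_eta1_opp X _ _ (cc_w1 _ _ Hw)).
      cbv beta in E. intros t' x' Ht' Hx'. specialize (E t' x' Ht' Hx').
      rewrite Ropp_0 in E. exact E.
    - intros y. auto_derive; trivial. ring.
    - intros e' _. split; auto_derive; trivial; ring.
    - apply (vanishes_at_1_lipschitz _ 7); [lra|].
      intros e' He'. assert (0 <= 1 + 2 * e' + 4 * e' ^ 2 <= 7) by nra.
      rewrite Rabs_pos_eq; nra.
    - intros t' x' e' HS' HT' Hd. specialize (Hdata t' x' e' HS' HT' Hd).
      simpl in HS'.
      assert (E1 : exp (- beta * x') <= 1).
      { rewrite <- exp_0. apply exp_nondecreasing.
        assert (0 <= beta * x') by (apply Rmult_le_pos; lra). lra. }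
      assert (E2 : 1 + 2 * e' + 4 * e' ^ 2 <= 7) by nra.
      assert (E3 : 0 <= 1 + 2 * e' + 4 * e' ^ 2) by nra.
      assert (E4 : c0 / 7 * exp (- beta * x') <= c0 / 7) by nra.
      assert (c0 / 7 * exp (- beta * x') * ((1 - e') * (1 + 2 * e' + 4 * e' ^ 2))
         <= c0 / 7 * ((1 - e') * 7)); [|lra].
      specialize (Hexp x').
      apply Rmult_le_compat; try lra; [apply Rmult_le_pos; lra|].
      apply Rmult_le_compat_l; lra.
    - intros t' x' Ht' Hx' Hlt.
      assert (HS' : closed_crocco_domain_inf X (t', x', 0)) by (simpl; lra).
      destruct (Rmult_integral _ _ (cc_eta0 _ _ Hw t' x' ltac:(lra) ltac:(lra)))
          as [E|E].
      + (* w = 0 here, so the equation forces ∂τ w = 0 *)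
        right. exists (- d_tau X w (t', x', 0)).
        assert (Ep := crocco_equation_closed X w _ Hw HS'). simpl coord in Ep.
        split.
        * apply (is_derive_opp (fun s => w (s, x', 0))).
          apply (is_pd_is_derive (closed_crocco_domain_inf X) Tau w (t', x', 0)).
          -- exists (mkposreal t' ltac:(lra)). intros s Hs.
             change (Rabs (s - t') < t') in Hs. apply Rabs_def2 in Hs.
             simpl. lra.
          -- apply (C_on_is_pd 1); trivial.
             apply limit_point_closed_domain; trivial.
        * rewrite E in Ep. lra.
      + left. exists (- d_eta X w (t', x', 0)). split.
        * apply is_pd_opp. apply (C_on_is_pd 1); trivial.
          apply limit_point_closed_domain; trivial.
        * rewrite E. specialize (Hexp x'). lra.
    - intros t' x' e' HT' Hp Hlt.
      assert (HS' : closed_crocco_domain_inf X (t', x', e')) by (simpl in *; lra).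
      assert (E := crocco_equation_closed X w _ Hw HS'). simpl coord in E.
      exists (w (t', x', e') ^ 2), (- d_tau X w (t', x', e')),
        (- d_xi X w (t', x', e')), (- d2_eta X w (t', x', e')).
      split; [apply pow2_ge_0|]. split.
      + apply has_jet_opp. apply has_jet_solution; trivial.
      + simpl in Hp. specialize (Hexp x').
        assert (Hd : 0 <= beta * e' * ((1 - e') * (1 + 2 * e' + 4 * e' ^ 2))
                       + w (t', x', e') ^ 2 * (4 - 24 * e')).
        { assert (W0 := pow2_ge_0 (w (t', x', e'))).
          destruct (Rle_lt_dec e' (1 / 6)) as [He'|He'].
          - apply Rplus_le_le_0_compat; apply Rmult_le_pos; try lra; nra.
          - destruct (Hbd _ _ _ HS' HT') as [B0 B1].
            assert (W1 : w (t', x', e') ^ 2 <= (/ c0) ^ 2 * ((1 - e') / mu)).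
            { apply Rle_trans with
                ((/ c0 * (1 - e') * sqrt (- ln (mu * (1 - e')))) ^ 2).
              - apply pow_incr. lra.
              - rewrite Rmult_assoc, Rpow_mult_distr.
                apply Rmult_le_compat_l; [apply pow2_ge_0|].
                apply sqr_log_barrier; lra. }
            assert (W2 : 20 * w (t', x', e') ^ 2 <= beta / 6 * (1 - e')).
            { unfold beta.
              replace (120 / (c0 ^ 2 * mu) / 6 * (1 - e')) with
                (20 * ((/ c0) ^ 2 * ((1 - e') / mu))); [lra|].
              field. lra. }
            assert (W3 : beta * (1 / 6) * ((1 - e') * 1) <=
              beta * e' * ((1 - e') * (1 + 2 * e' + 4 * e' ^ 2))).
            { apply Rmult_le_compat; nra. }
            nra. }
        assert (0 <= c0 / 7 * exp (- beta * x') *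
          (beta * e' * ((1 - e') * (1 + 2 * e' + 4 * e' ^ 2))
                       + w (t', x', e') ^ 2 * (4 - 24 * e'))) by
          (apply Rmult_le_pos; lra).
        lra. }
  simpl in HS.
  assert (E1 : exp (- beta * X) <= exp (- beta * x)).
  { apply exp_nondecreasing.
    assert (beta * x <= beta * X) by (apply Rmult_le_compat_l; lra). lra. }
  apply Rle_trans with (c0 / 7 * exp (- beta * x)
     * ((1 - e) * (1 + 2 * e + 4 * e ^ 2))); [|lra].
  assert (0 < exp (- beta * X)) by apply exp_pos.
  apply Rmult_le_compat; try nra.
Qed.

(** * Barriers for the tangential derivatives *)

Lemma is_derive_power_barrier (alpha e : R) :
  e < 1 ->
  is_derive (fun e => Rpower (1 - e) alpha) e
    (- (alpha * Rpower (1 - e) alpha / (1 - e))) /\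
  is_derive (fun e => - (alpha * Rpower (1 - e) alpha / (1 - e))) e
    (- (alpha * (1 - alpha) * Rpower (1 - e) alpha / (1 - e) ^ 2)).
Proof.
  intros He. unfold Rpower.
  split; (auto_derive; replace (1 + - e) with (1 - e) by ring;
    [repeat split; lra|field; lra]).
Qed.

(** The power barrier is a supersolution if w ∂η²w <= 2 δ: - w² ∂η² gives
    α (1 - α) w² / (1 - η)² >= α (1 - α) b² >= 10 δ times the barrier, while the
    zero-order term costs at most 4 δ times the barrier. *)
Lemma linearised_le_power (X T delta b alpha C : R) (w f : point -> R) :
  0 < X -> 0 < b -> 0 < alpha < 1 -> 0 < C -> 0 <= delta ->
  10 * delta <= alpha * (1 - alpha) * b ^ 2 ->
  linearised X T w f ->
  (forall p, coord Tau p <= T -> interior_domain X p ->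
     w p * d2_eta X w p <= 2 * delta) ->
  (forall p, closed_crocco_domain_inf X p -> coord Tau p <= T ->
     b * (1 - coord Eta p) <= w p) ->
  (forall t x e, closed_crocco_domain_inf X (t, x, e) -> t <= T ->
     t = 0 \/ x = 0 -> f (t, x, e) <= C * Rpower (1 - e) alpha) ->
  forall t x e, closed_crocco_domain_inf X (t, x, e) -> t <= T ->
    f (t, x, e) <= C * Rpower (1 - e) alpha.
Proof.
  intros X0 b0 Ha HC Hd Hdb Hf Hq Hw Hdata.
  apply (linearised_le X T (4 * delta) w f (fun _ => C) (fun _ => 0)
    (fun e => Rpower (1 - e) alpha)
    (fun e => - (alpha * Rpower (1 - e) alpha / (1 - e)))
    (fun e => - (alpha * (1 - alpha) * Rpower (1 - e) alpha / (1 - e) ^ 2)));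
    trivial; try lra.
  - intros p Hp Hi. specialize (Hq p Hp Hi). lra.
  - intros x. apply (is_derive_const (V := R_NormedModule)).
  - intros e He. apply is_derive_power_barrier. lra.
  - intros eps Heps. exists (Rpower eps (1 / alpha)).
    split; [apply exp_pos|]. intros e He.
    rewrite Rabs_pos_eq by (left; apply exp_pos).
    replace eps with (Rpower (Rpower eps (1 / alpha)) alpha) at 1.
    + apply Rlt_Rpower_l; lra.
    + rewrite Rpower_mult. replace (1 / alpha * alpha) with 1 by (field; lra).
      apply Rpower_1; trivial.
  - intros _. assert (0 < C * (alpha * Rpower (1 - 0) alpha / (1 - 0))); [|lra].
    apply Rmult_lt_0_compat; trivial. apply Rdiv_lt_0_compat; [|lra].
    apply Rmult_lt_0_compat; [lra|apply exp_pos].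
  - intros t x e HT Hp. specialize (Hq (t, x, e) HT Hp).
    assert (HS : closed_crocco_domain_inf X (t, x, e)) by (simpl in *; lra).
    specialize (Hw (t, x, e) HS HT). simpl coord in Hw. simpl in HS.
    set (W := w (t, x, e)) in *. set (P := Rpower (1 - e) alpha).
    assert (P0 : 0 < P) by apply exp_pos.
    assert (W2 : b ^ 2 * (1 - e) ^ 2 <= W ^ 2).
    { rewrite <- Rpow_mult_distr. apply pow_incr. split; trivial.
      apply Rmult_le_pos; lra. }
    assert (E2 : 0 < / (1 - e) ^ 2) by (apply Rinv_0_lt_compat, pow_lt; lra).
    assert (W3 : b ^ 2 <= W ^ 2 / (1 - e) ^ 2).
    { replace (b ^ 2) with (b ^ 2 * (1 - e) ^ 2 * / (1 - e) ^ 2)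
        by (field; lra).
      apply Rmult_le_compat_r; lra. }
    assert (Ha2 : 0 < alpha * (1 - alpha)) by (apply Rmult_lt_0_compat; lra).
    assert (H : alpha * (1 - alpha) * b ^ 2
       <= alpha * (1 - alpha) * (W ^ 2 / (1 - e) ^ 2)).
    { apply Rmult_le_compat_l; lra. }
    assert (CP : 0 < C * P) by (apply Rmult_lt_0_compat; trivial).
    assert (2 * (W * d2_eta X w (t, x, e)) * (C * P) <=
      alpha * (1 - alpha) * (W ^ 2 / (1 - e) ^ 2) * (C * P)).
    { apply Rmult_le_compat_r; lra. }
    unfold Rdiv in *. lra.
Qed.

(** The barrier is A e^ξ (1 - η) (2 + η) with A = δ b / (4 e^X).  Near η = 1 the
    transport term η A e^ξ (1 - η) (2 + η) outweighs the zero-order term because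
    12 δ <= 1.  Near η = 0, where transport is lost, concavity does so because
    w² >= b² (1 - η)² and 40 δ <= b². *)
Lemma linearised_le_exp (X T delta b : R) (w f : point -> R) :
  0 < X -> 0 < b -> 0 < delta -> 12 * delta <= 1 -> 40 * delta <= b ^ 2 ->
  linearised X T w f ->
  (forall p, coord Tau p <= T -> interior_domain X p ->
     w p * d2_eta X w p <= 2 * delta) ->
  (forall p, closed_crocco_domain_inf X p -> coord Tau p <= T ->
     b * (1 - coord Eta p) <= w p) ->
  (forall t x e, closed_crocco_domain_inf X (t, x, e) -> t <= T ->
     t = 0 \/ x = 0 -> f (t, x, e) <= delta * b / (2 * exp X) * (1 - e)) ->
  forall t x e, closed_crocco_domain_inf X (t, x, e) -> t <= T ->
    f (t, x, e) <= 3 / 4 * (delta * b * (1 - e)).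
Proof.
  intros X0 b0 Hd Hd1 Hdb Hf Hq Hw Hdata t x e HS HT.
  set (A := delta * b / (4 * exp X)).
  assert (eX := exp_pos X).
  assert (db : 0 < delta * b) by (apply Rmult_lt_0_compat; trivial).
  assert (A0 : 0 < A) by (apply Rdiv_lt_0_compat; lra).
  assert (HAX : A * exp X = delta * b / 4) by (unfold A; field; lra).
  assert (H : f (t, x, e) <= A * exp x * ((1 - e) * (2 + e))).
  { apply (linearised_le X T (4 * delta) w f (fun x => A * exp x)
      (fun x => A * exp x)
      (fun e => (1 - e) * (2 + e)) (fun e => -1 - 2 * e) (fun _ => -2));
      trivial; try lra.
    - intros p Hp Hi. specialize (Hq p Hp Hi). lra.
    - intros y. auto_derive; trivial. ring.
    - intros y _. split; auto_derive; trivial; ring.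
    - apply (vanishes_at_1_lipschitz _ 3); [lra|].
      intros e' He'. rewrite Rabs_pos_eq; nra.
    - intros t' x' e' HS' HT' Hd'. specialize (Hdata t' x' e' HS' HT' Hd').
      simpl in HS'. apply Rle_trans with (1 := Hdata).
      replace (delta * b / (2 * exp X) * (1 - e')) with
        (A * 1 * ((1 - e') * 2)) by (unfold A; field; lra).
      assert (1 <= exp x') by (rewrite <- exp_0; apply exp_nondecreasing; lra).
      apply Rmult_le_compat; nra.
    - intros y. assert (0 < A * exp y); [|lra].
      apply Rmult_lt_0_compat; trivial. apply exp_pos.
    - intros t' x' e' HT' Hp. specialize (Hq (t', x', e') HT' Hp).
      assert (HS' : closed_crocco_domain_inf X (t', x', e')) by (simpl in *; lra).
      specialize (Hw (t', x', e') HS' HT'). simpl coord in Hw. simpl in Hp.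
      set (W := w (t', x', e')) in *.
      assert (W2 : b ^ 2 * (1 - e') ^ 2 <= W ^ 2).
      { rewrite <- Rpow_mult_distr. apply pow_incr. split; trivial.
        apply Rmult_le_pos; lra. }
      assert (Ax : 0 < A * exp x').
      { apply Rmult_lt_0_compat; trivial. apply exp_pos. }
      assert (Hk : 0 < (1 - e') * (2 + e')) by (apply Rmult_lt_0_compat; lra).
      assert (H1 : 2 * (W * d2_eta X w (t', x', e')) * ((1 - e') * (2 + e'))
         <= 4 * delta * ((1 - e') * (2 + e'))).
      { apply Rmult_le_compat_r; lra. }
      assert (H2 : 4 * delta * ((1 - e') * (2 + e')) <= 12 * delta * (1 - e')).
      { assert (0 <= delta * (1 - e') * (1 - e')); [|lra].
        repeat apply Rmult_le_pos; lra. }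
      assert (H3 : 12 * delta * (1 - e') <=
          e' * ((1 - e') * (2 + e')) + 2 * W ^ 2).
      { destruct (Rle_lt_dec e' (1 / 2)) as [He|He].
        - assert (0 <= e' * ((1 - e') * (2 + e'))) by
            (apply Rmult_le_pos; lra).
          assert (b ^ 2 * (1 / 2 * (1 - e')) <= b ^ 2 * (1 - e') ^ 2).
          { apply Rmult_le_compat_l; [apply pow2_ge_0|nra]. }
          assert (40 * delta * (1 - e') <= b ^ 2 * (1 - e')).
          { apply Rmult_le_compat_r; lra. }
          nra.
        - assert (0 <= W ^ 2) by apply pow2_ge_0.
          assert (12 * delta * (1 - e') <= 1 * (1 - e')) by
            (apply Rmult_le_compat_r; lra).
          assert (1 * (1 - e') <= (e' * (2 + e')) * (1 - e')).
          { apply Rmult_le_compat_r; nra. }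
          lra. }
      assert (H4 : A * exp x' * (2 * (W * d2_eta X w (t', x', e'))
              * ((1 - e') * (2 + e')))
         <= A * exp x' * (e' * ((1 - e') * (2 + e')) + 2 * W ^ 2)).
      { apply Rmult_le_compat_l; lra. }
      lra. }
  simpl in HS. apply Rle_trans with (1 := H).
  apply Rle_trans with (A * exp X * ((1 - e) * 3)).
  - assert (exp x <= exp X) by (apply exp_nondecreasing; lra).
    assert (0 < exp x) by apply exp_pos.
    apply Rmult_le_compat; nra.
  - rewrite HAX. lra.
Qed.

(** * Continuation in time *)

(** Continuation in time.  Let Ts be the supremum of the times before which
    q <= M.  The implication applies up to Ts and gives q <= m there; since m < M and
    q extends continuously to the compact set η <= 1, the bound q <= M persists for
    a short time, so Ts = T. *)
Lemma bootstrap (X T m M : R) (q : point -> R) (l : R -> R -> R) :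
  0 < X -> 0 <= T -> m < M ->
  continuous_on (closed_crocco_domain_inf X) q -> extends_at_eta1 X q l ->
  (forall T', 0 <= T' <= T ->
     (forall p, coord Tau p <= T' -> interior_domain X p -> q p <= M) ->
     forall p, closed_crocco_domain_inf X p -> coord Tau p <= T' -> q p <= m) ->
  forall p, closed_crocco_domain_inf X p -> coord Tau p <= T -> q p <= m.
Proof.
  intros X0 T0 HmM Hc Hl Hstep.
  set (E := fun T' => 0 <= T' <= T /\ forall p, closed_crocco_domain_inf X p ->
              coord Tau p < T' -> q p <= M).
  destruct (completeness E) as [Ts [Hub Hlub]].
  { exists T. intros t [Ht _]. lra. }
  { exists 0. split; [lra|]. intros [[t x] e] HS Ht. simpl in *. lra. }
  assert (Ts0 : 0 <= Ts).
  { apply Hub. split; [lra|]. intros [[t x] e] HS Ht. simpl in *. lra. }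
  assert (TsT : Ts <= T) by (apply Hlub; intros t [Ht _]; lra).
  assert (HE : forall p, closed_crocco_domain_inf X p -> coord Tau p < Ts ->
            q p <= M).
  { intros p HS Hp. apply NNPP. intros Hn.
    assert (Ts <= coord Tau p); [|lra].
    apply Hlub. intros t [Ht Hq]. apply Rnot_lt_le. intros Hlt.
    apply Hn, Hq; trivial. }
  assert (Hin : forall p, coord Tau p <= Ts -> interior_domain X p -> q p <= M).
  { intros [[t x] e] Ht Hp. simpl coord in Ht. apply Rnot_lt_le. intros Hlt.
    assert (HS : closed_crocco_domain_inf X (t, x, e)) by (simpl in *; lra).
    assert (Hc' : continuous_on (closed_crocco_domain_inf X) (fun p => q p + - M)).
    { apply continuous_on_plus; trivial. apply continuous_on_forall.
      intros r _. apply continuous_const. }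
    destruct (continuous_on_pos_near X _ t x e Hc' HS) as [d [d0 Hd]].
    { lra. }
    simpl in Hp. set (k := Rmin (d / 2) (t / 2)).
    assert (k0 : 0 < k) by (apply Rmin_pos; lra).
    assert (k1 : k <= d / 2) by apply Rmin_l.
    assert (k2 : k <= t / 2) by apply Rmin_r.
    assert (HS' : closed_crocco_domain_inf X (t - k, x, e)) by (simpl; lra).
    specialize (Hd _ _ _ HS').
    rewrite (Rminus_diag x), (Rminus_diag e), Rabs_R0 in Hd.
    specialize (Hd ltac:(apply Rabs_def1; lra) d0 d0).
    specialize (HE _ HS'). simpl coord in HE. specialize (HE ltac:(lra)). lra. }
  assert (Hm := Hstep Ts (conj Ts0 TsT) Hin).
  assert (TT : Ts = T); [|subst Ts; exact Hm].
  apply Rle_antisym; trivial. apply Rnot_lt_le. intros HTlt.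
  (* if g is bounded by C, then q can exceed M only from the time Ts + / C on *)
  set (g := fun p : point =>
    if excluded_middle_informative
         (closed_crocco_domain_inf X p /\ M < q p /\ Ts < coord Tau p)
    then / (coord Tau p - Ts) else 0).
  destruct (locally_bounded_box (Ts + 1) X g) as [C HC].
  { intros [[t x] e] Hb. simpl in Hb.
    destruct (Rle_lt_dec t Ts) as [Ht|Ht].
    - exists 0.
      assert (Hnear : within (closed_crocco_domain_inf X)
                (locally ((t, x, e) : point)) (fun r => q r <= M)).
      { destruct (Rlt_dec e 1) as [He|He].
        - assert (HS : closed_crocco_domain_inf X (t, x, e)) by (simpl; lra).
          assert (Hl1 := proj1 (continuous_on_eps _ _) Hc _ HS (M - m)
            ltac:(lra)).
          specialize (Hm _ HS Ht). revert Hl1. apply filter_imp.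
          intros r Hr. apply Rabs_def2 in Hr. lra.
        - assert (e = 1) by lra. subst e.
          assert (Hlm : l t x <= m).
          { apply Rnot_lt_le. intros Hlt.
            assert (Hl1 := proj1 (extends_at_eta1_eps _ _ _) Hl t x
              ltac:(lra) ltac:(lra) (l t x - m) ltac:(lra)).
            apply locally_point in Hl1. destruct Hl1 as [d [d0 Hd]].
            set (k := Rmin (d / 2) (1 / 2)).
            assert (k0 : 0 < k) by (apply Rmin_pos; lra).
            assert (k1 : k <= d / 2) by apply Rmin_l.
            assert (k2 : k <= 1 / 2) by apply Rmin_r.
            specialize (Hd t x (1 - k)).
            rewrite (Rminus_diag t), (Rminus_diag x), Rabs_R0 in Hd.
            assert (HS : closed_crocco_domain_inf X (t, x, 1 - k))
              by (simpl; lra).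
            specialize (Hd d0 d0 ltac:(apply Rabs_def1; lra) HS).
            apply Rabs_def2 in Hd. specialize (Hm _ HS Ht). lra. }
          assert (Hl1 := proj1 (extends_at_eta1_eps _ _ _) Hl t x
              ltac:(lra) ltac:(lra) (M - m) ltac:(lra)).
          revert Hl1. apply filter_imp.
          intros r Hr. apply Rabs_def2 in Hr. lra. }
      revert Hnear. unfold within. apply filter_imp. intros r Hr _. unfold g.
      destruct (excluded_middle_informative _) as [[H1 [H2 H3]]|_]; [|lra].
      specialize (Hr H1). lra.
    - exists (/ ((t - Ts) / 2)). apply locally_point.
      exists ((t - Ts) / 2). split; [lra|].
      intros t' x' e' Ht' _ _ _. unfold g. simpl coord.
      apply Rabs_def2 in Ht'.
      destruct (excluded_middle_informative _) as [[H1 [H2 H3]]|_].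
      + apply Rinv_le_contravar; lra.
      + left. apply Rinv_0_lt_compat. lra. }
  set (d := / (1 + Rabs C)).
  assert (aC := Rabs_pos C). assert (bC := Rle_abs C).
  assert (d0 : 0 < d) by (apply Rinv_0_lt_compat; lra).
  assert (d1 : d <= 1).
  { rewrite <- Rinv_1. apply Rinv_le_contravar; lra. }
  assert (Rmin T (Ts + d) <= Ts).
  2: { unfold Rmin in *. destruct (Rle_dec T (Ts + d)); lra. }
  apply Hub. assert (m1 := Rmin_l T (Ts + d)). assert (m2 := Rmin_r T (Ts + d)).
  split.
  { split; trivial. apply Rmin_glb; lra. }
  intros [[t x] e] HS Ht. simpl coord in Ht. apply Rnot_lt_le. intros Hlt.
  assert (Hts : Ts < t).
  { apply Rnot_le_lt. intros Hle. specialize (Hm _ HS Hle). lra. }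
  specialize (HC (t, x, e) ltac:(simpl in *; lra)). unfold g in HC.
  destruct (excluded_middle_informative _) as [_|Hn]; [|apply Hn; auto].
  simpl coord in HC.
  assert (/ d < / (t - Ts)).
  { apply Rinv_lt_contravar; [apply Rmult_lt_0_compat; lra|lra]. }
  unfold d in *. rewrite Rinv_inv in *. lra.
Qed.

(** * The a priori estimates *)

Lemma min_on_between (a b m : R) (f : R -> R) (s : R) :
  a <= s <= b -> (forall r, a <= r <= b -> m <= f r) ->
  m <= min_on a b f <= f s.
Proof.
  intros Hs Hm. unfold min_on.
  set (E := fun y => exists s, a <= s <= b /\ y = f s).
  destruct (Glb_Rbar_correct E) as [Hlb Hgl].
  assert (H1 : Rbar_le (Glb_Rbar E) (f s)) by (apply Hlb; exists s; auto).
  assert (H2 : Rbar_le m (Glb_Rbar E)).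
  { apply Hgl. intros y [r [Hr ->]]. simpl. auto. }
  destruct (Glb_Rbar E) as [g| |]; simpl in *; [auto|contradiction|contradiction].
Qed.

Lemma oleinik_classical (X : R) (w0 w1 : R -> R -> R) (w : point -> R) :
  0 < X -> oleinik_monotone_solution X w0 w1 w -> crocco_classical X w.
Proof.
  intros X0 [C2 [C3 [Hsol [E0 [Ex [Et _]]]]]]. split; trivial.
  - intros [[t x] e] Hp. simpl in Hp.
    destruct (Hsol t ltac:(lra)) as [Heq _]. apply Heq. simpl. lra.
  - intros t x Ht Hx.
    destruct (Hsol (t + 1) ltac:(lra)) as [_ [Hb _]].
    apply (Hb t x); lra.
Qed.

Lemma linearised_tangential (X T : R) (w : point -> R) :
  crocco_classical X w ->
  (forall t x, 0 < t <= T -> 0 < x < X -> 0 < w (t, x, 0)) ->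
  linearised X T w (d_tau X w) /\ linearised X T w (d_xi X w).
Proof.
  intros Hw Hpos. assert (C2 := cc_C2 _ _ Hw).
  split; (split; [|split; [|split]]).
  - exact (C_on_continuous 1 _ _ (C_on_pd 1 _ _ Tau C2)).
  - exact (cc_dtau1 _ _ Hw).
  - intros t x e. apply (linearised_equation X w Tau); trivial. discriminate.
  - intros t x Ht Hx.
    apply (neumann_linearised X w Tau); auto; [discriminate|lra].
  - exact (C_on_continuous 1 _ _ (C_on_pd 1 _ _ Xi C2)).
  - exact (cc_dxi1 _ _ Hw).
  - intros t x e. apply (linearised_equation X w Xi); trivial. discriminate.
  - intros t x Ht Hx.
    apply (neumann_linearised X w Xi); auto; [discriminate|lra].
Qed.

(** The bound on ∂ξ w + ∂τ w is linear in 1 - η; it implies the bound by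
    (δ / 2) w as soon as 2 b (1 - η) <= w. *)
Definition tangential_bounds (X b delta alpha C : R) (w : point -> R)
    (p : point) : Prop :=
  let s := 1 - coord Eta p in
  - C * Rpower s alpha <= d_xi X w p + d_tau X w p
    <= 3 / 4 * (delta * b * s) /\
  - C * Rpower s alpha <= d_tau X w p <= b * delta * Rpower s alpha.

Lemma tangential_bounds_of_diffusion (X T b delta alpha C : R) (w : point -> R) :
  crocco_classical X w ->
  0 < b -> 0 < alpha < 1 -> 0 < C -> 0 < delta -> 12 * delta <= 1 ->
  10 * delta <= alpha * (1 - alpha) * b ^ 2 ->
  (forall t x, 0 < t <= T -> 0 < x < X -> 0 < w (t, x, 0)) ->
  (forall p, closed_crocco_domain_inf X p -> coord Tau p <= T ->
     b * (1 - coord Eta p) <= w p) ->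
  (forall t x e, closed_crocco_domain_inf X (t, x, e) -> t <= T ->
     t = 0 \/ x = 0 ->
     - C * Rpower (1 - e) alpha <= d_xi X w (t, x, e) + d_tau X w (t, x, e)
       <= delta * b / (2 * exp X) * (1 - e) /\
     - C * Rpower (1 - e) alpha <= d_tau X w (t, x, e)
       <= b * delta * Rpower (1 - e) alpha) ->
  (forall p, coord Tau p <= T -> interior_domain X p ->
     w p * d2_eta X w p <= 2 * delta) ->
  forall p, closed_crocco_domain_inf X p -> coord Tau p <= T ->
    tangential_bounds X b delta alpha C w p.
Proof.
  intros Hw b0 Ha HC Hd Hd1 Hdb Hpos Hlow Hdata Hq [[t x] e] HS HT.
  simpl coord in HT. assert (X0 := cc_X _ _ Hw).
  destruct (linearised_tangential X T w Hw Hpos) as [Lt Lx].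
  assert (Lv := linearised_plus X T w _ _ Lx Lt).
  assert (bd : 0 < b * delta) by (apply Rmult_lt_0_compat; trivial).
  assert (Hdb2 : 40 * delta <= b ^ 2).
  { assert (0 <= (alpha - 1 / 2) ^ 2) by apply pow2_ge_0.
    assert (alpha * (1 - alpha) <= 1 / 4) by lra.
    assert (alpha * (1 - alpha) * b ^ 2 <= 1 / 4 * b ^ 2); [|lra].
    apply Rmult_le_compat_r; [apply pow2_ge_0|trivial]. }
  assert (Hneg : forall f, linearised X T w f ->
    (forall t x e, closed_crocco_domain_inf X (t, x, e) -> t <= T ->
     t = 0 \/ x = 0 -> - C * Rpower (1 - e) alpha <= f (t, x, e)) ->
    - C * Rpower (1 - e) alpha <= f (t, x, e)).
  { intros f Lf Hf.
    assert (- f (t, x, e) <= C * Rpower (1 - e) alpha); [|lra].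
    apply (linearised_le_power X T delta b alpha C w (fun p => - f p));
      trivial; [lra|apply linearised_opp; trivial|].
    intros t' x' e' HS' HT' H. specialize (Hf t' x' e' HS' HT' H). lra. }
  unfold tangential_bounds. simpl coord. repeat split.
  - apply (Hneg (fun p => d_xi X w p + d_tau X w p)); trivial.
    intros t' x' e' HS' HT' H. apply (Hdata t' x' e'); trivial.
  - apply (linearised_le_exp X T delta b w (fun p => d_xi X w p + d_tau X w p));
      trivial.
    intros t' x' e' HS' HT' H. apply (Hdata t' x' e'); trivial.
  - apply Hneg; trivial.
    intros t' x' e' HS' HT' H. apply (Hdata t' x' e'); trivial.
  - apply (linearised_le_power X T delta b alpha (b * delta) w); trivial; [lra|].
    intros t' x' e' HS' HT' H. apply (Hdata t' x' e'); trivial.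
Qed.

Lemma Rpower_le_1 (s alpha : R) : 0 < s <= 1 -> 0 <= alpha -> Rpower s alpha <= 1.
Proof.
  intros Hs Ha. unfold Rpower. rewrite <- exp_0. apply exp_nondecreasing.
  assert (ln s <= 0) by (rewrite <- ln_1; apply ln_le; lra).
  assert (0 <= alpha * - ln s) by (apply Rmult_le_pos; lra). lra.
Qed.

(** The equation gives w² ∂η²w = (1 - η) ∂τ w + η (∂ξ w + ∂τ w), which is at most
    (1 + 3 / 4) δ b (1 - η) <= δ w. *)
Lemma diffusion_of_tangential_bounds (X b delta alpha C : R) (w : point -> R)
    (p : point) :
  crocco_classical X w ->
  0 < b -> 0 < alpha -> 0 < delta ->
  closed_crocco_domain_inf X p ->
  2 * b * (1 - coord Eta p) <= w p ->
  tangential_bounds X b delta alpha C w p ->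
  w p * d2_eta X w p <= delta.
Proof.
  intros Hw b0 Ha Hd HS Hlow [[_ Hv] [_ Hu]].
  assert (E := crocco_equation_closed X w p Hw HS).
  assert (He : 0 <= coord Eta p < 1).
  { destruct p as [[t x] y]. simpl in *. lra. }
  set (e := coord Eta p) in *.
  assert (HP := Rpower_le_1 (1 - e) alpha ltac:(lra) ltac:(lra)).
  assert (bd : 0 < b * delta) by (apply Rmult_lt_0_compat; trivial).
  assert (Hu' : (1 - e) * d_tau X w p <= (1 - e) * (b * delta * 1)).
  { apply Rmult_le_compat_l; [lra|]. apply Rle_trans with (1 := Hu).
    apply Rmult_le_compat_l; lra. }
  assert (Hs : 0 < b * delta * (1 - e)) by (apply Rmult_lt_0_compat; lra).
  assert (Hv' : e * (d_xi X w p + d_tau X w p) <= b * delta * (1 - e)).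
  { apply Rle_trans with (e * (3 / 4 * (delta * b * (1 - e)))).
    - apply Rmult_le_compat_l; lra.
    - replace (b * delta * (1 - e)) with (1 * (b * delta * (1 - e))) at 1 by ring.
      replace (e * (3 / 4 * (delta * b * (1 - e)))) with
        (3 / 4 * e * (b * delta * (1 - e))) by ring.
      apply Rmult_le_compat_r; lra. }
  assert (w0 : 0 < w p).
  { assert (0 < b * (1 - e)) by (apply Rmult_lt_0_compat; lra). lra. }
  assert (Hw2 : delta * (2 * b * (1 - e)) <= delta * w p).
  { apply Rmult_le_compat_l; lra. }
  apply Rmult_le_reg_l with (w p); trivial.
  replace (w p * (w p * d2_eta X w p)) with (w p ^ 2 * d2_eta X w p) by ring.
  rewrite <- E. lra.
Qed.

(** Turns the factor (δ b)^(1/α) of the boundary data into δ b. *)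
Lemma Rpower_inv_le (y alpha : R) :
  0 < y <= 1 -> 0 < alpha < 1 -> Rpower y (1 / alpha) <= y.
Proof.
  intros Hy Ha. rewrite <- (Rpower_1 y) at 2 by lra.
  unfold Rpower. apply exp_nondecreasing.
  assert (ln y <= 0) by (rewrite <- ln_1; apply ln_le; lra).
  assert (1 <= 1 / alpha).
  { rewrite <- (Rinv_1) at 1. unfold Rdiv. rewrite Rmult_1_l.
    apply Rinv_le_contravar; lra. }
  assert (0 <= (1 / alpha - 1) * - ln y) by (apply Rmult_le_pos; lra). lra.
Qed.

Theorem theorem1p1 :
  forall X c0 mu : R,
  0 < X -> 0 < c0 < 1 -> 0 < mu < 1 / 100 ->
  exists beta : R, 0 < beta /\
  forall T alpha0 C1 : R,
  0 < T -> 0 < alpha0 < 1 -> 0 < C1 ->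
  let b := c0 / 4 * exp (- beta * X) * exp (- (8 / 3)) in
  let K := exp X * Rmax 2 (2 * Rpower C1 (1 / alpha0 - 1)) in
  let delta :=
    Rmin (1 / 10 * min_on (alpha0 / 2) alpha0 (fun a => a * (1 - a) * b ^ 2))
      (Rmin (1 / (321 * exp X))
            (Rmin 1 C1 / (b * Rpower 2 alpha0))) in
  forall (w0 w1 : R -> R -> R) (w : point -> R),
  oleinik_monotone_solution X w0 w1 w ->
  (forall t e, 0 <= t <= T -> 0 <= e < 1 ->
     c0 * (1 - e) <= w1 t e <= / c0 * (1 - e) * sqrt (- ln (mu * (1 - e)))) ->
  (forall x e, 0 <= x <= X -> 0 <= e < 1 ->
     c0 * (1 - e) <= w0 x e <= / c0 * (1 - e) * sqrt (- ln (mu * (1 - e)))) ->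
  (forall p, face_xi0 T p \/ face_tau0 X p ->
     let e := coord Eta p in
     - C1 * Rpower (1 - e) alpha0 <= d_xi X w p + d_tau X w p
       <= Rpower (delta * b) (1 / alpha0) / K * (1 - e) /\
     - C1 * Rpower (1 - e) alpha0 <= d_tau X w p
       <= b * delta * Rpower (1 - e) alpha0) ->
  forall p, crocco_domain T X p ->
     let e := coord Eta p in
     b * (1 - e) <= w p <= / c0 * (1 - e) * sqrt (- ln (mu * (1 - e))) /\
     - C1 * Rpower (1 - e) alpha0 <= d_xi X w p + d_tau X w p
       <= delta / 2 * w p /\
     w p * d2_eta X w p <= 2 * delta /\
     - C1 * Rpower (1 - e) alpha0 <= d_tau X w p
       <= b * delta * Rpower (1 - e) alpha0.
Proof.
  intros X c0 mu X0 Hc0 Hmu.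
  assert (Hcm : 0 < c0 ^ 2 * mu).
  { apply Rmult_lt_0_compat; [apply pow_lt|]; lra. }
  exists (120 / (c0 ^ 2 * mu)). split; [apply Rdiv_lt_0_compat; lra|].
  intros T alpha C T0 Ha HC b K delta w0 w1 w Hol Hw1 Hw0 Hface.
  assert (Hw := oleinik_classical X w0 w1 w X0 Hol).
  assert (b0 : 0 < b).
  { unfold b. repeat apply Rmult_lt_0_compat; try apply exp_pos; lra. }
  assert (Hdel : 0 < delta /\ 12 * delta <= 1 /\
            10 * delta <= alpha * (1 - alpha) * b ^ 2 /\ delta * b <= 1).
  { assert (eX : 1 < exp X) by (rewrite <- exp_0; apply exp_increasing; trivial).
    assert (b2 : 0 < b ^ 2) by (apply pow_lt; trivial).
    assert (P2 : 1 <= Rpower 2 alpha).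
    { rewrite <- (Rpower_O 2) by lra. apply Rle_Rpower; lra. }
    destruct (min_on_between (alpha / 2) alpha
      (alpha / 2 * (1 - alpha) * b ^ 2) (fun a => a * (1 - a) * b ^ 2) alpha)
      as [M1 M2]; [lra| |].
    { intros r Hr. apply Rmult_le_compat_r; [lra|].
      apply Rmult_le_compat; lra. }
    assert (M0 : 0 < alpha / 2 * (1 - alpha) * b ^ 2).
    { apply Rmult_lt_0_compat; trivial. apply Rmult_lt_0_compat; lra. }
    assert (N0 : 0 < Rmin 1 C) by (apply Rmin_pos; lra).
    assert (N1 := Rmin_l 1 C).
    assert (D1 := Rmin_l
      (1 / 10 * min_on (alpha / 2) alpha (fun a => a * (1 - a) * b ^ 2))
      (Rmin (1 / (321 * exp X)) (Rmin 1 C / (b * Rpower 2 alpha)))).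
    assert (D2 := Rmin_r
      (1 / 10 * min_on (alpha / 2) alpha (fun a => a * (1 - a) * b ^ 2))
      (Rmin (1 / (321 * exp X)) (Rmin 1 C / (b * Rpower 2 alpha)))).
    assert (D3 := Rmin_l (1 / (321 * exp X)) (Rmin 1 C / (b * Rpower 2 alpha))).
    assert (D4 := Rmin_r (1 / (321 * exp X)) (Rmin 1 C / (b * Rpower 2 alpha))).
    fold delta in D1, D2.
    assert (bP : 0 < b * Rpower 2 alpha) by (apply Rmult_lt_0_compat; lra).
    split; [|split; [|split]].
    - unfold delta. repeat apply Rmin_pos.
      + lra.
      + apply Rdiv_lt_0_compat; lra.
      + apply Rdiv_lt_0_compat; lra.
    - assert (1 / (321 * exp X) <= 1 / 321); [|lra].
      apply Rmult_le_compat_l; [lra|]. apply Rinv_le_contravar; lra.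
    - lra.
    - assert (H : delta <= Rmin 1 C / (b * Rpower 2 alpha)) by lra.
      apply Rmult_le_compat_r with (r := b * Rpower 2 alpha) in H; [|lra].
      replace (Rmin 1 C / (b * Rpower 2 alpha) * (b * Rpower 2 alpha))
        with (Rmin 1 C) in H by (field; split; lra).
      destruct (Rle_lt_dec delta 0) as [Hd|Hd].
      + assert (0 <= - delta * b) by (apply Rmult_le_pos; lra). lra.
      + assert (delta * b * 1 <= delta * b * Rpower 2 alpha); [|lra].
        apply Rmult_le_compat_l; [apply Rmult_le_pos|]; lra. }
  destruct Hdel as [d0 [d12 [d10 db1]]].
  assert (db0 : 0 < delta * b) by (apply Rmult_lt_0_compat; trivial).
  assert (Hfaces : forall t x e, closed_crocco_domain_inf X (t, x, e) ->
     t <= T -> t = 0 \/ x = 0 ->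
     (face_xi0 T (t, x, e) \/ face_tau0 X (t, x, e)) /\
     c0 * (1 - e) <= w (t, x, e)
       <= / c0 * (1 - e) * sqrt (- ln (mu * (1 - e)))).
  { intros t x e HS HT Htx. simpl in HS.
    destruct Hol as [_ [_ [Hsol _]]].
    destruct (Hsol T T0) as [_ [_ [Hi Hb]]].
    destruct Htx as [->| ->].
    - split; [right; simpl; lra|].
      rewrite Hi by lra. apply Hw0; lra.
    - split; [left; simpl; lra|].
      rewrite Hb by lra. apply Hw1; lra. }
  assert (Hwpos : forall t x e, closed_crocco_domain_inf X (t, x, e) ->
     t <= T -> 0 <= w (t, x, e)
       <= / c0 * (1 - e) * sqrt (- ln (mu * (1 - e)))).
  { intros t x e HS HT. split.
    - apply (crocco_nonneg X T); trivial. intros t' x' e' HS' HT' H.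
      destruct (Hfaces t' x' e' HS' HT' H) as [_ [Hl _]].
      simpl in HS'. assert (0 <= c0 * (1 - e')); [|lra].
      apply Rmult_le_pos; lra.
    - apply (crocco_le_log_barrier X T); trivial; [lra|].
      intros t' x' e' HS' HT' H. apply (Hfaces t' x' e'); trivial. }
  (* the gap exp (- 8 / 3) <= 2 / 7 leaves twice the lower bound that is asked;
     this is the room needed to close the bound on w ∂η²w *)
  assert (Hlow : forall p, closed_crocco_domain_inf X p -> coord Tau p <= T ->
     2 * b * (1 - coord Eta p) <= w p).
  { intros [[t x] e] HS HT. simpl coord in *.
    apply Rle_trans with
      (c0 / 7 * exp (- (120 / (c0 ^ 2 * mu)) * X) * (1 - e)).
    - simpl in HS. apply Rmult_le_compat_r; [lra|].
      unfold b. set (E := exp (- (120 / (c0 ^ 2 * mu)) * X)).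
      assert (E0 : 0 < E) by apply exp_pos.
      assert (E8 : exp (- (8 / 3)) <= 2 / 7).
      { rewrite exp_Ropp. replace (2 / 7) with (/ (7 / 2)) by field.
        apply Rinv_le_contravar; [lra|].
        generalize (exp_ineq1_le (8 / 3)). lra. }
      replace (c0 / 7 * E) with (2 * (c0 / 4 * E * (2 / 7))) by field.
      assert (0 < c0 / 4 * E) by (apply Rmult_lt_0_compat; lra).
      assert (c0 / 4 * E * exp (- (8 / 3)) <= c0 / 4 * E * (2 / 7)); [|lra].
      apply Rmult_le_compat_l; lra.
    - apply (crocco_ge_barrier X T c0 mu); trivial.
      intros t' x' e' HS' HT' H. apply (Hfaces t' x' e'); trivial. }
  assert (Hlow1 : forall p, closed_crocco_domain_inf X p -> coord Tau p <= T ->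
     b * (1 - coord Eta p) <= w p).
  { intros p HS HT. apply Rle_trans with (2 := Hlow p HS HT).
    assert (0 <= b * (1 - coord Eta p)); [|lra].
    apply Rmult_le_pos; [lra|]. destruct p as [[t x] e]. simpl in *. lra. }
  assert (Hpos : forall t x, 0 < t <= T -> 0 < x < X -> 0 < w (t, x, 0)).
  { intros t x Ht Hx. apply Rlt_le_trans with (b * (1 - 0)); [lra|].
    apply (Hlow1 (t, x, 0)); simpl; lra. }
  assert (HK : forall s, 0 <= s ->
     Rpower (delta * b) (1 / alpha) / K * s <= delta * b / (2 * exp X) * s).
  { intros s Hs. apply Rmult_le_compat_r; trivial.
    assert (eX := exp_pos X).
    assert (K2 : 2 * exp X <= K).
    { unfold K. rewrite (Rmult_comm 2). apply Rmult_le_compat_l; [lra|].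
      apply Rmax_l. }
    apply Rmult_le_compat.
    - left. apply exp_pos.
    - left. apply Rinv_0_lt_compat. lra.
    - apply Rpower_inv_le; lra.
    - apply Rinv_le_contravar; lra. }
  assert (Htan : forall T', T' <= T ->
    (forall p, coord Tau p <= T' -> interior_domain X p ->
       w p * d2_eta X w p <= 2 * delta) ->
    forall p, closed_crocco_domain_inf X p -> coord Tau p <= T' ->
      tangential_bounds X b delta alpha C w p).
  { intros T' HT' Hq.
    apply (tangential_bounds_of_diffusion X T' b delta alpha C w); trivial.
    - intros t x Ht Hx. apply Hpos; lra.
    - intros p HS Hp. apply Hlow1; [trivial|lra].
    - intros t x e HS Ht Htx.
      destruct (Hfaces t x e HS ltac:(lra) Htx) as [Hf _].
      destruct (Hface _ Hf) as [[F1 F2] F3]. simpl coord in F1, F2, F3.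
      simpl in HS. specialize (HK (1 - e) ltac:(lra)).
      split; [split; lra|trivial]. }
  assert (Hq : forall p, closed_crocco_domain_inf X p -> coord Tau p <= T ->
            w p * d2_eta X w p <= delta).
  { assert (C2 := cc_C2 _ _ Hw).
    destruct Hol as [_ [_ [_ [_ [_ [_ [l [_ Hl]]]]]]]].
    apply (bootstrap X T delta (2 * delta) (fun p => w p * d2_eta X w p) l);
      trivial; try lra.
    - apply continuous_on_mult; [exact (C_on_continuous _ _ _ C2)|].
      exact (C_on_continuous 0 _ _ (C_on_pd 0 _ _ Eta (C_on_pd 1 _ _ Eta C2))).
    - intros T' HT' Hq p HS Hp.
      apply (diffusion_of_tangential_bounds X b delta alpha C); trivial; try lra.
      + apply Hlow; trivial; lra.
      + apply (Htan T'); trivial; lra. }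
  intros p Hp.
  assert (HS : closed_crocco_domain_inf X p).
  { destruct p as [[t x] e]. simpl in *. lra. }
  assert (HT : coord Tau p <= T).
  { destruct p as [[t x] e]. simpl in *. lra. }
  destruct (Htan T (Rle_refl T)) with (p := p) as [[V1 V2] [U1 U2]]; trivial.
  { intros r Hr Hi. assert (closed_crocco_domain_inf X r).
    { apply (locally_singleton _ _ (locally_closed_domain X r Hi)). }
    specialize (Hq r H Hr). lra. }
  specialize (Hq p HS HT). specialize (Hlow p HS HT).
  specialize (Hlow1 p HS HT).
  cbv zeta.
  split; [split; trivial|split; [split; trivial|split; [lra|split; trivial]]].
  - destruct p as [[t x] e]. apply Hwpos; trivial.
  - assert (delta * (2 * b * (1 - coord Eta p)) <= delta * w p) by
      (apply Rmult_le_compat_l; lra).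
    assert (0 <= delta * b * (1 - coord Eta p)); [|lra].
    apply Rmult_le_pos; [lra|]. destruct p as [[t x] e]. simpl in *. lra.
Qed.
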